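(* Let $\mu$ be a positive finite Borel measure on $[0,1)$ and let $v,w$ be weights on $\mathbb{D}$. Consider: (i) $C(v,w):=\sup_{0\le r<1}w(r)\int_0^1\frac{d\mu(t)}{v(t)(1-tr)}<\infty$; (ii) $I_\mu:H^\infty_v\to H^\infty_w$ is well defined and continuous. Then (i) implies (ii). If in addition $v$ is essential, then (i) and (ii) are equivalent.
   Context: $\mathbb{D}$ is the open unit disc and $H(\mathbb{D})$ the holomorphic functions on $\mathbb{D}$. A weight is a function $v:\mathbb{D}\to(0,\infty)$ that is radial ($v(z)=v(|z|)$), continuous, non-increasing in $|z|$, with $\lim_{r\to1^-}v(r)=0$. $H^\infty_v=\{f\in H(\mathbb{D}):\|f\|_v:=\sup_{z\in\mathbb{D}}v(z)|f(z)|<\infty\}$. A weight $v$ is essential if there is $c>0$ with $c/v(z)\le\sup\{|f(z)|:\|f\|_v\le1\}\le1/v(z)$ for all $z\in\mathbb{D}$. $I_\mu(f)(z)=\int_0^1\frac{f(t)}{1-tz}\,d\mu(t)$ whenever this defines a holomorphic function on $\mathbb{D}$. *)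

(* Defs.v *)
From HB Require Import structures.
From mathcomp Require Import all_boot all_order all_algebra.
From mathcomp Require Import all_classical all_reals all_analysis.
From mathcomp Require Import complex.
Set Implicit Arguments. Unset Strict Implicit. Unset Printing Implicit Defensive.
Import Order.TTheory GRing.Theory Num.Theory.
Import numFieldNormedType.Exports.
Local Open Scope classical_set_scope.
Local Open Scope ring_scope.

Section Defs.
Variable R : realType.

Definition cabs (z : R[i]) : R := Normc.normc z.

Definition disc (z : R[i]) : Prop := cabs z < 1.

Definition holo_disc (f : R[i] -> R[i]) : Prop :=
  forall z, disc z -> exists d : R[i], forall e : R, 0 < e ->
    exists2 delta : R, 0 < delta &
      forall h : R[i], h != 0 -> cabs h < delta -> disc (z + h) ->
        cabs ((f (z + h) - f z) / h - d) <= e.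

(* A weight, given by its radial profile v : [0,1) -> R, i.e. v(z) = v(|z|):
   positive, continuous, non-increasing, tending to 0 as r -> 1^- *)
Definition is_weight (v : R -> R) : Prop :=
  [/\ (forall r, 0 <= r -> r < 1 -> 0 < v r),
      {within `[0, 1[, continuous v},
      (forall r s, 0 <= r -> r <= s -> s < 1 -> v s <= v r)
    & v x @[x --> (1 : R)^'-] --> 0].

Definition vbounded (v : R -> R) (f : R[i] -> R[i]) (M : R) : Prop :=
  forall z, disc z -> v (cabs z) * cabs (f z) <= M.

Definition in_Hinf (v : R -> R) (f : R[i] -> R[i]) : Prop :=
  holo_disc f /\ exists M : R, vbounded v f M.

Definition Ikernel (f : R[i] -> R[i]) (z : R[i]) (t : R) : R[i] :=
  f (t%:C)%C / (1 - (t%:C)%C * z).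

Definition Imu_integrable (mu : {measure set R -> \bar R})
    (f : R[i] -> R[i]) (z : R[i]) : Prop :=
  mu.-integrable `[0, 1[ (fun t => (complex.Re (Ikernel f z t))%:E) /\
  mu.-integrable `[0, 1[ (fun t => (complex.Im (Ikernel f z t))%:E).

Definition Imu (mu : {measure set R -> \bar R}) (f : R[i] -> R[i]) (z : R[i])
    : R[i] :=
  Complex (Rintegral mu `[0, 1[ (fun t => complex.Re (Ikernel f z t)))
          (Rintegral mu `[0, 1[ (fun t => complex.Im (Ikernel f z t))).

Definition Cvw_finite (mu : {measure set R -> \bar R}) (v w : R -> R) : Prop :=
  exists C : R, forall r, 0 <= r -> r < 1 ->
    ((w r)%:E * \int[mu]_(t in `[0%R, 1%R[) ((v t * (1 - t * r))^-1)%:E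
       <= C%:E)%E.

(* condition (ii): I_mu : H^infty_v -> H^infty_w is well defined and continuous
   (i.e. bounded, as it is linear) *)
Definition Imu_bounded (mu : {measure set R -> \bar R}) (v w : R -> R) : Prop :=
  (forall f, in_Hinf v f ->
     (forall z, disc z -> Imu_integrable mu f z) /\ in_Hinf w (Imu mu f)) /\
  exists C : R, forall f (M : R), holo_disc f -> vbounded v f M ->
     vbounded w (Imu mu f) (C * M).

Definition unit_ball_v (v : R -> R) : set (R[i] -> R[i]) :=
  [set f | holo_disc f /\ vbounded v f 1].

Definition essential (v : R -> R) : Prop :=
  exists2 c : R, 0 < c & forall z, disc z ->
    c / v (cabs z) <= sup [set cabs (f z) | f in unit_ball_v v] /\
    sup [set cabs (f z) | f in unit_ball_v v] <= 1 / v (cabs z).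

End Defs.

(* Main.v *)
(* The sufficiency is a direct estimate: |1 - tz| >= 1 - t|z|.

   For the necessity, put u = 1/v.  It is enough to find, for every s < 1, a
   polynomial F with nonnegative coefficients such that |F(z)| <= K u(|z|) on
   the disc and F >= c u on [0, s], with K and c independent of s: then
   I_mu(F)(r) bounds c times the integral of u(t)/(1 - tr) over [0, s], and s
   tends to 1.
   Hadamard's three circles theorem, applied to f in the unit ball with |f(t)|
   comparable to u(t), gives a monomial a r^n that is <= u everywhere and
   comparable to u at t.  Such monomials, taken at points where u doubles, are
   thinned out greedily so that both before and after the point where one of
   them is large the others decay geometrically; F is 1 plus their sum.

   Three circles only needs a maximum principle on annuli.  That is reduced to
   squares by a strictly subharmonic perturbation, and on squares it follows
   from Goursat's theorem: if f(0) = 1, comparing the contour integrals of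
   f(z)^q/z on a fixed and on a tiny square shows that |f|^q >= 1/4 somewhere
   far from 0, for every q. *)
Require Import Defs.
From HB Require Import structures.
From mathcomp Require Import all_boot all_order all_algebra.
From mathcomp Require Import all_classical all_reals all_analysis.
From mathcomp Require Import complex.
From mathcomp Require Import measurable_realfun lra ring.
Set Implicit Arguments. Unset Strict Implicit. Unset Printing Implicit Defensive.
Import Order.TTheory GRing.Theory Num.Theory.
Import numFieldNormedType.Exports.
Local Open Scope classical_set_scope.
Local Open Scope ring_scope.

(** * Complex modulus and complex derivative *)

Section Complex.
Variable R : realType.
Implicit Types (z h : R[i]) (x y : R).
Local Notation C := (R[i]^o).

(** The bound on [I_mu] gives (i) only through a test function that is comparable to u on a whole
    segment of the radius and produces no cancellation in the integral, whereas an essential weight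
    supplies, for each t, a separate function that is good at t alone. Nonnegative coefficients
    settle the cancellation: F is positive on the radius and |F(z)| <= F(|z|). As to comparability,
    three circles makes the logarithm of the maximum modulus convex in log r, and a supporting line
    of a convex function is here the logarithm of a power of r; restricting to integer powers costs
    a factor t, which is harmless once t >= 1/2. The monomials cannot all be added, since many of
    them may be comparable to u at the same point and their sum would then exceed any fixed multiple
    of u. What makes thinning possible is that the ratio of two monomials is monotone: if it drops
    between two points, it stays low beyond the second. Finitely many levels are treated at a time
    so that F is a polynomial; the constants do not depend on their number. *)

Lemma cabs_ge0 z : 0 <= cabs z.
Proof. by case: z => a b; exact: sqrtr_ge0. Qed.

Lemma normC_cabs z : `|z| = (cabs z)%:C%C.
Proof. by []. Qed.

Lemma cabsM z h : cabs (z * h) = cabs z * cabs h.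
Proof. exact: Normc.normcM. Qed.

Lemma cabsN z : cabs (- z) = cabs z.
Proof. exact: normcN. Qed.

Lemma cabsV z : cabs z^-1 = (cabs z)^-1.
Proof. exact: Normc.normcV. Qed.

Lemma cabs_div z h : cabs (z / h) = cabs z / cabs h.
Proof. by rewrite cabsM cabsV. Qed.

Lemma ler_cabsD z h : cabs (z + h) <= cabs z + cabs h.
Proof. exact: le_normcD. Qed.

Lemma ler_cabsB z h : cabs (z - h) <= cabs z + cabs h.
Proof. by rewrite -(cabsN h); exact: ler_cabsD. Qed.

Lemma lerB_cabs z h : cabs z - cabs h <= cabs (z + h).
Proof.
by rewrite lerBlDr -{1}(addrK h z); exact: ler_cabsB.
Qed.

Lemma cabs_real x : cabs (x%:C)%C = `|x|.
Proof. by rewrite /cabs /= expr0n addr0 sqrtr_sqr. Qed.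

Lemma cabs0 : cabs (0 : R[i]) = 0.
Proof. exact: Normc.normc0. Qed.

Lemma cabs1 : cabs (1 : R[i]) = 1.
Proof. exact: Normc.normc1. Qed.

Lemma cabs_eq0 z : (cabs z == 0) = (z == 0).
Proof. by apply/eqP/eqP => [/Normc.eq0_normc//|->]; exact: cabs0. Qed.

Lemma cabs_gt0 z : (0 < cabs z) = (z != 0).
Proof. by rewrite lt0r cabs_ge0 cabs_eq0 andbT. Qed.

Lemma cabsX z n : cabs (z ^+ n) = cabs z ^+ n.
Proof. by elim: n => [|n IH]; rewrite ?expr0 ?cabs1// !exprS cabsM IH. Qed.

Lemma sqr_cabs z : cabs z ^+ 2 = complex.Re z ^+ 2 + complex.Im z ^+ 2.
Proof. by case: z => a b; rewrite sqr_sqrtr// addr_ge0// sqr_ge0. Qed.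

Lemma normr_Re_le z : `|complex.Re z| <= cabs z.
Proof.
rewrite -(@ler_pXn2r _ 2) ?nnegrE ?cabs_ge0// sqr_cabs real_normK ?num_real//.
by rewrite lerDl sqr_ge0.
Qed.

Lemma normr_Im_le z : `|complex.Im z| <= cabs z.
Proof.
rewrite -(@ler_pXn2r _ 2) ?nnegrE ?cabs_ge0// sqr_cabs real_normK ?num_real//.
by rewrite lerDr sqr_ge0.
Qed.

Lemma cabs_le_ReIm z : cabs z <= `|complex.Re z| + `|complex.Im z|.
Proof.
rewrite -(@ler_pXn2r _ 2) ?nnegrE ?cabs_ge0 ?addr_ge0// sqr_cabs sqrrD.
rewrite !real_normK ?num_real// addrAC lerDl mulrn_wge0//.
Qed.

Lemma ReB z h : complex.Re (z - h) = complex.Re z - complex.Re h.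
Proof. by case: z; case: h. Qed.

Lemma ImB z h : complex.Im (z - h) = complex.Im z - complex.Im h.
Proof. by case: z; case: h. Qed.

(** With [R[i]] as its own field of scalars, the derivative in direction 1 is the complex
    derivative. *)
Definition cderivable (f : R[i] -> R[i]) z := derivable (f : C -> C) z 1.

Definition ccontinuous (f : R[i] -> R[i]) z := {for z, continuous (f : C -> C)}.

(** Balls over [R[i]] have radii in [R[i]]; in its partial order a positive element has zero
    imaginary part, so real radii suffice. *)
Lemma nbhs_cabs z (P : R[i] -> Prop) :
  (\forall y \near (z : C), P y) <->
  exists2 r : R, 0 < r & forall h, cabs h < r -> P (z + h).
Proof.
split.
  move=> /(@nbhs_ballP _ C z P)[[r s]] /=; rewrite ltcE /= => /andP[/eqP s0 r0] H.
  exists r => // h hr; apply: H => /=; rewrite /ball /=.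
  by rewrite opprD addNKr normrN normC_cabs ltcE /= s0 eqxx.
move=> [r r0 H]; apply/(@nbhs_ballP _ C z P); exists (r%:C)%C => /=; first by rewrite ltcR.
move=> y; rewrite /ball /= normC_cabs ltcR => yr.
by rewrite -(subrKC z y); apply: H; rewrite -cabsN opprB.
Qed.

Lemma continuous_cabsP (f : R[i] -> R[i]) z :
  ccontinuous f z <->
  forall e : R, 0 < e -> exists2 r : R, 0 < r &
    forall h, cabs h < r -> cabs (f (z + h) - f z) <= e.
Proof.
split.
  move=> /cvgrPdist_le cf e e0.
  have /cf/nbhs_cabs [r r0 H] : 0 < (e%:C)%C :> R[i] by rewrite ltcR.
  by exists r => // h /H; rewrite normC_cabs lecR -cabsN opprB.
move=> H; apply/(@cvgrPdist_le _ C _ _ (nbhs_filter (z : C))) => -[e s] /=; rewrite ltcE /= => /andP[/eqP -> e0].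
have [r r0 {}H] := H _ e0.
apply/nbhs_cabs; exists r => // h /H.
by rewrite normC_cabs lecR -cabsN opprB.
Qed.

(** The form without a quotient covers h = 0 and is the affine approximation that Goursat's argument
    integrates. *)
Lemma derivable_cabsP (f : R[i] -> R[i]) z :
  cderivable f z <->
  exists d : R[i], forall e : R, 0 < e -> exists2 r : R, 0 < r &
    forall h, cabs h < r -> cabs (f (z + h) - f z - d * h) <= e * cabs h.
Proof.
pose q d h := cabs ((f (z + h) - f z) / h - d).
have qE d h : h != 0 -> cabs (f (z + h) - f z - d * h) = q d h * cabs h.
  by move=> h0; rewrite -cabsM mulrBl divfK.
have sE (h : C) : h^-1 *: ((f : C -> C) (h *: (1 : C) + z) - f z) = (f (z + h) - f z) / h.
  have -> : h *: (1 : C) = h by exact: mulr1.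
  by rewrite (addrC h); exact: mulrC.
have -> : cderivable f z <-> exists d : R[i],
    forall e : R, 0 < e -> exists2 r : R, 0 < r &
    forall h, h != 0 -> cabs h < r -> q d h <= e.
  split.
    move=> /cvg_ex[/= d /cvgrPdist_le df]; exists d => e e0.
    have /df : 0 < (e%:C)%C :> R[i] by rewrite ltcR.
    rewrite near_withinE near_simpl.
    move=> /nbhs_cabs[r r0 H]; exists r => // h h0 hr.
    have := H _ hr; rewrite add0r => /(_ h0).
    by rewrite normC_cabs lecR -cabsN opprB /= sE.
  move=> [d H]; apply/cvg_ex; exists d; apply/(@cvgrPdist_le _ C _ _ (dnbhs_filter (0 : C))) => -[e s] /=.
  rewrite ltcE /= => /andP[/eqP -> e0]; have [r r0 {}H] := H _ e0.
  rewrite near_withinE near_simpl; apply/nbhs_cabs.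
  exists r => // h hr; rewrite add0r => h0; have := H _ h0 hr.
  by rewrite normC_cabs lecR -cabsN opprB /= sE.
split=> -[d H]; exists d => e e0; have [r r0 {}H] := H _ e0; exists r => // h.
  move=> hr; have [->|h0] := eqVneq h 0; last by rewrite qE// ler_wpM2r ?cabs_ge0// H.
  by rewrite addr0 subrr mulr0 subrr cabs0 mulr0.
move=> h0 hr; have := H _ hr; rewrite qE// ler_pM2r// cabs_gt0//.
Qed.

Lemma holo_discP (f : R[i] -> R[i]) :
  holo_disc f <-> forall z, disc z -> cderivable f z.
Proof.
split=> H z dz.
  have [d {}H] := H z dz; apply/derivable_cabsP; exists d => e e0.
  have [r r0 {}H] := H e e0.
  (* Below 1 - |z| the increment cannot leave the disc, which removes the condition [disc (z + h)]
     of [holo_disc]. *)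
  exists (Num.min r (1 - cabs z)); first by rewrite lt_min r0 subr_gt0.
  move=> h; rewrite lt_min ltrBrDl => /andP[hr hz].
  have [->|h0] := eqVneq h 0.
    by rewrite addr0 subrr mulr0 subrr cabs0 mulr0.
  have -> : f (z + h) - f z - d * h = ((f (z + h) - f z) / h - d) * h.
    by rewrite mulrBl divfK.
  rewrite cabsM ler_wpM2r ?cabs_ge0//; apply: H => //.
  exact: le_lt_trans (ler_cabsD _ _) hz.
have /derivable_cabsP[d {}H] := H z dz; exists d => e e0.
have [r r0 {}H] := H e e0; exists r => // h h0 hr _.
have := H _ hr; rewrite -[X in cabs X](mulfVK h0) cabsM ler_pM2r ?cabs_gt0//.
by rewrite mulrBl mulfK.
Qed.

Lemma cderivable_continuous (f : R[i] -> R[i]) z :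
  cderivable f z -> ccontinuous f z.
Proof. by move=> /derivable1_diffP/differentiable_continuous. Qed.

End Complex.

(** * Bisection of rectangles *)

Section Bisection.
Variable R : realType.

Lemma nested_intervals (L : R) (a : nat -> R) : 0 <= L ->
  (forall n, a n <= a n.+1 /\ a n.+1 + L / 2 ^+ n.+1 <= a n + L / 2 ^+ n) ->
  exists p, forall n, a n <= p <= a n + L / 2 ^+ n.
Proof.
move=> L0 H.
have mono i j : a i <= a (i + j)%N /\
    a (i + j)%N + L / 2 ^+ (i + j) <= a i + L / 2 ^+ i.
  elim: j => [|j [IH1 IH2]]; first by rewrite addn0.
  have [H1 H2] := H (i + j)%N; rewrite addnS.
  by split; [exact: le_trans H1|exact: le_trans IH2].
have pos n : 0 <= L / 2 ^+ n by rewrite divr_ge0// exprn_ge0.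
have bound i j : a i <= a j + L / 2 ^+ j.
  case: (leqP i j) => [/subnKC <-|/ltnW/subnKC <-].
    by rewrite (le_trans (mono i (j - i)%N).1)// lerDl.
  by rewrite (le_trans _ (mono j (i - j)%N).2)// lerDl.
have hs : has_sup (range a).
  split; first by exists (a 0%N), 0%N.
  by exists (a 0%N + L / 2 ^+ 0) => _ [n _ <-].
exists (sup (range a)) => n; apply/andP; split.
  by apply: ub_le_sup; [exact: hs.2|exists n].
by apply: ge_sup; [exact: hs.1|move=> _ [m _ <-]].
Qed.

(** [P n a c] speaks of the rectangle with lower left corner (a, c) and sides L / 2^n, M / 2^n. If P
    fails for a rectangle, it fails for one of its quarters; the nested failing rectangles shrink to
    a point, where the local hypothesis contradicts them. *)
Lemma bisection (L M a0 c0 : R) (P : nat -> R -> R -> Prop) :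
  0 <= L -> 0 <= M ->
  (forall n a c, P n.+1 a c -> P n.+1 (a + L / 2 ^+ n.+1) c ->
     P n.+1 a (c + M / 2 ^+ n.+1) ->
     P n.+1 (a + L / 2 ^+ n.+1) (c + M / 2 ^+ n.+1) -> P n a c) ->
  (forall p q, a0 <= p <= a0 + L -> c0 <= q <= c0 + M ->
     exists n, forall a c, a <= p <= a + L / 2 ^+ n -> c <= q <= c + M / 2 ^+ n ->
       a0 <= a -> a + L / 2 ^+ n <= a0 + L -> c0 <= c ->
       c + M / 2 ^+ n <= c0 + M -> P n a c) ->
  P 0%N a0 c0.
Proof.
move=> L0 M0 quarter loc; apply: contrapT => nP0.
have half (K : R) n : K / 2 ^+ n = K / 2 ^+ n.+1 + K / 2 ^+ n.+1.
  by rewrite -mulrDl -mulr2n -(mulr_natr K) exprS invfM mulrA mulfK// pnatr_eq0.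
have pos (K : R) n : 0 <= K -> 0 <= K / 2 ^+ n.
  by move=> K0; rewrite divr_ge0// exprn_ge0.
(* Corners are stored together with the failure of P, so that choosing a failing quarter can be
   iterated by [nat_rect]. *)
have step n (s : {ac : R * R | ~ P n ac.1 ac.2}) :
    {t : {ac : R * R | ~ P n.+1 ac.1 ac.2} |
      (sval t).1 \in [:: (sval s).1; (sval s).1 + L / 2 ^+ n.+1] /\
      (sval t).2 \in [:: (sval s).2; (sval s).2 + M / 2 ^+ n.+1]}.
  case: s => -[a c] /= nP; apply: cid; apply: contrapT => nex; apply: nP.
  apply: quarter; apply: contrapT => nP; apply: nex.
  - by exists (exist _ (a, c) nP); rewrite /= !inE !eqxx.
  - by exists (exist _ (a + L / 2 ^+ n.+1, c) nP); rewrite /= !inE !eqxx ?orbT.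
  - by exists (exist _ (a, c + M / 2 ^+ n.+1) nP); rewrite /= !inE !eqxx ?orbT.
  - by exists (exist _ (a + L / 2 ^+ n.+1, c + M / 2 ^+ n.+1) nP);
      rewrite /= !inE !eqxx ?orbT.
pose s := nat_rect (fun n => {ac : R * R | ~ P n ac.1 ac.2})
  (exist _ (a0, c0) nP0) (fun n t => sval (step n t)).
have sS n : (sval (s n.+1)).1 \in [:: (sval (s n)).1; (sval (s n)).1 + L / 2 ^+ n.+1] /\
    (sval (s n.+1)).2 \in [:: (sval (s n)).2; (sval (s n)).2 + M / 2 ^+ n.+1].
  exact: (svalP (step n (s n))).
pose a n := (sval (s n)).1; pose c n := (sval (s n)).2.
have aP n : a n <= a n.+1 /\ a n.+1 + L / 2 ^+ n.+1 <= a n + L / 2 ^+ n.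
  have [+ _] := sS n; rewrite -/(a n.+1) -/(a n) !inE (half L n).
  have := pos L n.+1 L0.
  by move=> + /orP[/eqP->|/eqP->]; lra.
have cP n : c n <= c n.+1 /\ c n.+1 + M / 2 ^+ n.+1 <= c n + M / 2 ^+ n.
  have [_ +] := sS n; rewrite -/(c n.+1) -/(c n) !inE (half M n).
  have := pos M n.+1 M0.
  by move=> + /orP[/eqP->|/eqP->]; lra.
have [p pP] := nested_intervals L0 aP.
have [q qP] := nested_intervals M0 cP.
have mono (K : R) (x : nat -> R) :
    (forall n, x n <= x n.+1 /\ x n.+1 + K / 2 ^+ n.+1 <= x n + K / 2 ^+ n) ->
    forall n, x 0%N <= x n /\ x n + K / 2 ^+ n <= x 0%N + K.
  move=> H; elim=> [|n [IH1 IH2]]; first by rewrite expr0 divr1.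
  by have [H1 H2] := H n; split; [exact: le_trans H1|exact: le_trans IH2].
have [||n Pn] := loc p q.
- by have := pP 0%N; rewrite expr0 divr1.
- by have := qP 0%N; rewrite expr0 divr1.
have [a1 a2] := mono _ _ aP n; have [c1 c2] := mono _ _ cP n.
exact: (svalP (s n) (Pn _ _ (pP n) (qP n) a1 a2 c1 c2)).
Qed.

End Bisection.

(** * Contour integrals along rectangles *)

Section SegmentIntegral.
Variable R : realType.
Implicit Types (a b m : R) (g h : R -> R).

Definition itg a b g : R := \int[lebesgue_measure]_(x in `[a, b]) g x.

Definition ctn_on a b g := {within `[a, b], continuous g}.

Lemma ctn_on_pt a b g :
  (forall x, a <= x <= b -> {for x, continuous g}) -> ctn_on a b g.
Proof.
by move=> H; apply: continuous_in_subspaceT => x; rewrite inE /= in_itv /= => /H.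
Qed.

Lemma ctn_onW a b a' b' g : a <= a' -> b' <= b -> ctn_on a b g -> ctn_on a' b' g.
Proof.
move=> aa bb; apply: continuous_subspaceW => x /=; rewrite !in_itv /=.
by case/andP => /(le_trans aa) -> /le_trans ->.
Qed.

Lemma ctn_on_integrable a b g : ctn_on a b g ->
  lebesgue_measure.-integrable `[a, b] (EFin \o g).
Proof. by move=> cg; apply: continuous_compact_integrable => //; exact: segment_compact. Qed.

Lemma itg_add a m b g : a <= m -> m <= b -> ctn_on a b g ->
  itg a b g = itg a m g + itg m b g.
Proof.
move=> am mb cg.
have cg2 : ctn_on m b g by exact: ctn_onW cg.
apply/eqP; rewrite -subr_eq0 opprD addrA subr_eq0 /itg; apply/eqP.
rewrite Rintegral_itvB ?bnd_simp//; last exact: ctn_on_integrable.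
rewrite Rintegral_itv_obnd_cbnd//.
apply: integrableS (ctn_on_integrable cg2) => //.
by move=> x /=; rewrite !in_itv /= => /andP[/ltW -> ->].
Qed.

Lemma ctn_onB a b g h : ctn_on a b g -> ctn_on a b h -> ctn_on a b (fun x => g x - h x).
Proof. by move=> cg ch x; apply: cvgB; [exact: cg|exact: ch]. Qed.

Lemma itgB a b g h : ctn_on a b g -> ctn_on a b h ->
  itg a b (fun x => g x - h x) = itg a b g - itg a b h.
Proof.
by move=> cg ch; rewrite /itg RintegralB//; exact: ctn_on_integrable.
Qed.

Lemma itg_cst a b M : a <= b -> itg a b (cst M) = M * (b - a).
Proof.
move=> ab; rewrite /itg Rintegral_cst//.
have /= -> := lebesgue_measure_itv `[a, b]; rewrite lte_fin.
by case: ltgtP ab => //= -> _; rewrite subrr.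
Qed.

Lemma ctn_on_cst a b M : ctn_on a b (cst M).
Proof. by move=> x; exact: cvg_cst. Qed.

Lemma itg_le a b g M : a <= b -> ctn_on a b g ->
  (forall x, a <= x <= b -> g x <= M) -> itg a b g <= M * (b - a).
Proof.
move=> ab cg gM; rewrite -itg_cst//; apply: le_Rintegral => //.
- exact: ctn_on_integrable.
- by apply: ctn_on_integrable; exact: ctn_on_cst.
Qed.

Lemma itg_ge a b g M : a <= b -> ctn_on a b g ->
  (forall x, a <= x <= b -> M <= g x) -> M * (b - a) <= itg a b g.
Proof.
move=> ab cg gM; rewrite -itg_cst//; apply: le_Rintegral => //.
- by apply: ctn_on_integrable; exact: ctn_on_cst.
- exact: ctn_on_integrable.
Qed.

End SegmentIntegral.

Section Goursat.
Variable R : realType.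
Implicit Types (a b c d x y : R) (f : R[i] -> R[i]).
Local Notation C := (R[i]^o).

Definition in_rect a b c d (z : R[i]) :=
  (a <= complex.Re z <= b) && (c <= complex.Im z <= d).

(* The real part of the counterclockwise contour integral of f along the
   boundary of [a, b] x [c, d]. *)
Definition contour f a b c d : R :=
  itg a b (fun x => complex.Re (f (Complex x c))) -
  itg a b (fun x => complex.Re (f (Complex x d))) -
  itg c d (fun y => complex.Im (f (Complex b y))) +
  itg c d (fun y => complex.Im (f (Complex a y))).

Lemma continuous_Re_horizontal f x c : ccontinuous f (Complex x c) ->
  {for x, continuous (fun t => complex.Re (f (Complex t c)))}.
Proof.
move=> /continuous_cabsP cf; apply/(@cvgrPdist_le _ R^o _ _ (nbhs_filter (x : R^o))) => e e0.
have [r r0 H] := cf e e0; apply/nbhs_ballP; exists r => //= t.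
rewrite /ball /= => xt.
have := H (t - x)%:C%C; rewrite cabs_real -(distrC x) => /(_ xt).
have -> : Complex x c + (t - x)%:C%C = Complex t c by simpc; rewrite subrKC.
apply: le_trans; apply: le_trans (normr_Re_le _).
by rewrite ReB distrC.
Qed.

Lemma continuous_Im_vertical f a y : ccontinuous f (Complex a y) ->
  {for y, continuous (fun t => complex.Im (f (Complex a t)))}.
Proof.
move=> /continuous_cabsP cf; apply/(@cvgrPdist_le _ R^o _ _ (nbhs_filter (y : R^o))) => e e0.
have [r r0 H] := cf e e0; apply/nbhs_ballP; exists r => //= t.
rewrite /ball /= => xt.
have := H (Complex 0 (t - y)).
have -> : cabs (Complex 0 (t - y)) = `|y - t|.
  by rewrite /cabs /= expr0n add0r sqrtr_sqr distrC.
move=> /(_ xt).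
have -> : Complex a y + Complex 0 (t - y) = Complex a t by simpc; rewrite subrKC.
apply: le_trans; apply: le_trans (normr_Im_le _).
by rewrite ImB distrC.
Qed.

Lemma ctn_on_Re f a b c :
  (forall x, a <= x <= b -> ccontinuous f (Complex x c)) ->
  ctn_on a b (fun x => complex.Re (f (Complex x c))).
Proof. by move=> H; apply: ctn_on_pt => x /H /continuous_Re_horizontal. Qed.

Lemma ctn_on_Im f a c d :
  (forall y, c <= y <= d -> ccontinuous f (Complex a y)) ->
  ctn_on c d (fun y => complex.Im (f (Complex a y))).
Proof. by move=> H; apply: ctn_on_pt => x /H /continuous_Im_vertical. Qed.

Lemma contour_splitx f a m b c d : a <= m -> m <= b ->
  (forall x, a <= x <= b -> ccontinuous f (Complex x c)) ->
  (forall x, a <= x <= b -> ccontinuous f (Complex x d)) ->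
  contour f a b c d = contour f a m c d + contour f m b c d.
Proof.
move=> am mb /ctn_on_Re Hc /ctn_on_Re Hd.
by rewrite /contour (itg_add am mb Hc) (itg_add am mb Hd); ring.
Qed.

Lemma contour_splity f a b c m d : c <= m -> m <= d ->
  (forall y, c <= y <= d -> ccontinuous f (Complex a y)) ->
  (forall y, c <= y <= d -> ccontinuous f (Complex b y)) ->
  contour f a b c d = contour f a b c m + contour f a b m d.
Proof.
move=> am mb /ctn_on_Im Hc /ctn_on_Im Hd.
by rewrite /contour (itg_add am mb Hc) (itg_add am mb Hd); ring.
Qed.

(** The affine part cancels exactly: with b2 the imaginary part of beta, it adds b2 (d - c) (b - a)
    to the difference of the horizontal sides and the same amount to that of the vertical ones. What
    remains is e times the perimeter. *)
Lemma contour_affine_le f a b c d (K e : R) (beta w : R[i]) : a <= b -> c <= d ->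
  (forall z, in_rect a b c d z -> ccontinuous f z) ->
  (forall z, in_rect a b c d z -> cabs (f z - w - beta * z) <= e) ->
  `|contour f a b c d| <= 2 * e * (b - a + (d - c)).
Proof.
move=> ab cd cf fe.
have Cc := @ctn_on_Re f a b c; have Cd := @ctn_on_Re f a b d.
have Ca := @ctn_on_Im f a c d; have Cb := @ctn_on_Im f b c d.
have {}Cc : ctn_on a b (fun x => complex.Re (f (Complex x c))).
  by apply: Cc => x xab; apply: cf; rewrite /in_rect /= xab lexx.
have {}Cd : ctn_on a b (fun x => complex.Re (f (Complex x d))).
  by apply: Cd => x xab; apply: cf; rewrite /in_rect /= xab cd lexx.
have {}Ca : ctn_on c d (fun x => complex.Im (f (Complex a x))).
  by apply: Ca => x xab; apply: cf; rewrite /in_rect /= xab ab lexx.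
have {}Cb : ctn_on c d (fun x => complex.Im (f (Complex b x))).
  by apply: Cb => x xab; apply: cf; rewrite /in_rect /= xab ab lexx.
have -> : contour f a b c d =
    itg a b (fun x => complex.Re (f (Complex x c)) - complex.Re (f (Complex x d))) -
    itg c d (fun x => complex.Im (f (Complex b x)) - complex.Im (f (Complex a x))).
  by rewrite !itgB// /contour; ring.
case: beta w fe => [b1 b2] [w1 w2] fe.
have Hre x y : a <= x <= b -> c <= y <= d ->
    `|complex.Re (f (Complex x y)) - w1 - (b1 * x - b2 * y)| <= e.
  move=> xab ycd; apply: le_trans (fe (Complex x y) _); last by rewrite /in_rect /= xab.
  by apply: le_trans (normr_Re_le _); case: (f _) => f1 f2; rewrite /=.
have Him x y : a <= x <= b -> c <= y <= d ->
    `|complex.Im (f (Complex x y)) - w2 - (b1 * y + b2 * x)| <= e.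
  move=> xab ycd; apply: le_trans (fe (Complex x y) _); last by rewrite /in_rect /= xab.
  by apply: le_trans (normr_Im_le _); case: (f _) => f1 f2; rewrite /=.
have h1 : (b2 * (d - c) - 2 * e) * (b - a) <=
    itg a b (fun x => complex.Re (f (Complex x c)) - complex.Re (f (Complex x d))) <=
    (b2 * (d - c) + 2 * e) * (b - a).
  apply/andP; split; [apply: itg_ge|apply: itg_le] => //; try exact: ctn_onB.
    move=> x xab; have := Hre x c xab; have := Hre x d xab.
    by rewrite !lexx !cd !ler_norml => /(_ isT) + /(_ isT); lra.
  move=> x xab; have := Hre x c xab; have := Hre x d xab.
  by rewrite !lexx !cd !ler_norml => /(_ isT) + /(_ isT); lra.
have h2 : (b2 * (b - a) - 2 * e) * (d - c) <=
    itg c d (fun x => complex.Im (f (Complex b x)) - complex.Im (f (Complex a x))) <=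
    (b2 * (b - a) + 2 * e) * (d - c).
  apply/andP; split; [apply: itg_ge|apply: itg_le] => //; try exact: ctn_onB.
    move=> x xab; have := Him a x _ xab; have := Him b x _ xab.
    by rewrite !lexx !ab !ler_norml => /(_ isT) + /(_ isT); lra.
  move=> x xab; have := Him a x _ xab; have := Him b x _ xab.
  by rewrite !lexx !ab !ler_norml => /(_ isT) + /(_ isT); lra.
move: h1 h2; set I1 := itg a b _; set I2 := itg c d _.
by rewrite ler_norml; nra.
Qed.

End Goursat.

(** * Goursat's theorem *)

Section GoursatTheorem.
Variable R : realType.
Implicit Types (a b c d x y : R) (f : R[i] -> R[i]).

Lemma exp2_archi (S r : R) : 0 < r -> exists n, S / 2 ^+ n < r.
Proof.
move=> r0; exists (Num.bound (`|S| / r)).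
rewrite ltr_pdivrMr ?exprn_gt0// (le_lt_trans (ler_norm _))//.
rewrite -ltr_pdivrMl// mulrC; apply: lt_le_trans (archi_boundP _) _.
  by rewrite divr_ge0// ltW.
by rewrite -natrX ler_nat ltnW// ltn_expl.
Qed.

Lemma goursat f a b c d : a <= b -> c <= d ->
  (forall z, in_rect a b c d z -> cderivable f z) ->
  contour f a b c d = 0.
Proof.
move=> ab cd df.
pose L := b - a; pose M := d - c; pose S := L + M.
have L0 : 0 <= L by rewrite subr_ge0.
have M0 : 0 <= M by rewrite subr_ge0.
have S0 : 0 <= S by rewrite addr_ge0.
have cf z : in_rect a b c d z -> ccontinuous f z.
  by move=> /df/cderivable_continuous.
suff H e : 0 < e -> `|contour f a b c d| <= e * S ^+ 2.
  apply/eqP; rewrite -normr_le0; apply/ler_addgt0Pr => e e0; rewrite add0r.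
  have S1 : 0 < S ^+ 2 + 1 by rewrite ltr_wpDl ?sqr_ge0.
  apply: le_trans (H (e / (S ^+ 2 + 1)) _) _; first by rewrite divr_gt0.
  by rewrite mulrAC ler_pdivrMr// ler_pM2l// lerDl.
move=> e0.
(* The bound is quadratic in the half-perimeter s, so four quarters with bound e s^2 give exactly e
   (2 s)^2 for the whole, and bisection loses nothing. *)
pose P n x y := a <= x -> x + L / 2 ^+ n <= b -> c <= y -> y + M / 2 ^+ n <= d ->
  `|contour f x (x + L / 2 ^+ n) y (y + M / 2 ^+ n)| <= e * (S / 2 ^+ n) ^+ 2.
have half (K : R) n : K / 2 ^+ n = K / 2 ^+ n.+1 + K / 2 ^+ n.+1.
  by rewrite -mulrDl -mulr2n -(mulr_natr K) exprS invfM mulrA mulfK// pnatr_eq0.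
have pos (K : R) n : 0 <= K -> 0 <= K / 2 ^+ n.
  by move=> K0; rewrite divr_ge0// exprn_ge0.
suff : P 0%N a c.
  by rewrite /P !expr0 !divr1 /L /M !subrKC !lexx; apply.
apply: (@bisection _ L M) => //.
  move=> n x y; rewrite /P (half L n) (half M n) (half S n).
  have := pos L n.+1 L0; have := pos M n.+1 M0.
  set l := L / _; set m := M / _; set s := S / _ => m0 l0 P1 P2 P3 P4 ax xb cy yd.
  rewrite (@contour_splitx _ f x (x + l)); try by lra.
  - rewrite (@contour_splity _ f x (x + l) y (y + m)); try by lra.
    + rewrite (@contour_splity _ f (x + l) _ y (y + m)); try by lra.
      * have {}P1 := P1 ltac:(lra) ltac:(lra) ltac:(lra) ltac:(lra).
        have {}P2 := P2 ltac:(lra) ltac:(lra) ltac:(lra) ltac:(lra).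
        have {}P3 := P3 ltac:(lra) ltac:(lra) ltac:(lra) ltac:(lra).
        have {}P4 := P4 ltac:(lra) ltac:(lra) ltac:(lra) ltac:(lra).
        rewrite (addrA x) (addrA y) (_ : (s + s) ^+ 2 = 4 * s ^+ 2); last by ring.
        move: P1 P2 P3 P4; rewrite !ler_norml.
        set c1 := contour _ _ _ _ _; set c2 := contour _ _ _ _ _.
        set c3 := contour _ _ _ _ _; set c4 := contour _ _ _ _ _.
        by set ss := s ^+ 2; lra.
      * by move=> t ht; apply: cf; rewrite /in_rect /=; apply/andP; split; lra.
      * by move=> t ht; apply: cf; rewrite /in_rect /=; apply/andP; split; lra.
    + by move=> t ht; apply: cf; rewrite /in_rect /=; apply/andP; split; lra.
    + by move=> t ht; apply: cf; rewrite /in_rect /=; apply/andP; split; lra.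
  - by move=> t ht; apply: cf; rewrite /in_rect /=; apply/andP; split; lra.
  - by move=> t ht; apply: cf; rewrite /in_rect /=; apply/andP; split; lra.
move=> p q; rewrite /L /M !subrKC => pab qcd.
have /derivable_cabsP[beta H] : cderivable f (Complex p q).
  by apply: df; rewrite /in_rect /= pab.
(* On a rectangle of half-perimeter s the approximation error is e/2 * s, and the factor 2 in
   [contour_affine_le] turns this into e s^2. *)
have [r r0 {}H] := H (e / 2) ltac:(lra).
have [n Sn] := exp2_archi S r0.
exists n => x y; rewrite -/L -/M => px qy ax xb cy yd _ _ _ _.
have l0 := pos L n L0; have m0 := pos M n M0; have s0 := pos S n S0.
have sE : S / 2 ^+ n = L / 2 ^+ n + M / 2 ^+ n by rewrite mulrDl.
set l := L / _ in l0 px xb sE *; set m := M / _ in m0 qy yd sE *.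
set s := S / _ in s0 Sn sE *.
apply: le_trans (@contour_affine_le _ f _ _ _ _ 0 (e / 2 * s) beta
  (f (Complex p q) - beta * Complex p q) _ _ _ _) _; try by lra.
- by move=> z; rewrite /in_rect => hz; apply: cf; rewrite /in_rect; apply/andP; split; lra.
- move=> z; rewrite /in_rect => hz.
  have hs : cabs (z - Complex p q) <= s.
    apply: le_trans (cabs_le_ReIm _) _; rewrite ReB ImB sE /=.
    by apply: lerD; rewrite ler_norml; lra.
  have := H (z - Complex p q) (le_lt_trans hs Sn).
  rewrite subrKC => Hz.
  have -> : f z - (f (Complex p q) - beta * Complex p q) - beta * z =
     f z - f (Complex p q) - beta * (z - Complex p q) by ring.
  by apply: le_trans Hz _; rewrite ler_wpM2l//; lra.
- by rewrite !(addrC x) !(addrC y) !addrK -sE expr2 le_eqVlt; apply/orP; left; apply/eqP; field.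
Qed.

End GoursatTheorem.

(** * Maximum principle on squares *)

Section MaximumPrinciple.
Variable R : realType.
Implicit Types (f g H : R[i] -> R[i]).
Local Notation C := (R[i]^o).

Lemma cderivableM f g z : cderivable f z -> cderivable g z ->
  cderivable (fun y => f y * g y) z.
Proof. by move=> df dg; exact: (@derivableM _ C f g _ _ df dg). Qed.

Lemma cderivableV f z : f z != 0 -> cderivable f z ->
  cderivable (fun y => (f y)^-1) z.
Proof. by move=> f0 df; exact: (@derivableV _ C f _ _ f0 df). Qed.

Lemma cderivableX f n z : cderivable f z ->
  cderivable (fun y => f y ^+ n) z.
Proof.
move=> df; elim: n => [|n IH]; first exact: (@derivable_cst _ C C 1).
rewrite (_ : (fun y => _) = (fun y => f y * f y ^+ n)); first exact: cderivableM.
by apply: funext => y; rewrite exprS.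
Qed.

Lemma cderivable_cst (w z : R[i]) : cderivable (fun=> w) z.
Proof. exact: derivable_cst. Qed.

Lemma cderivable_id (z : R[i]) : cderivable (fun y => y) z.
Proof. exact: derivable_id. Qed.

Lemma cderivableD f g z : cderivable f z -> cderivable g z ->
  cderivable (fun y => f y + g y) z.
Proof. by move=> df dg; exact: (@derivableD _ C C f g _ _ df dg). Qed.

Lemma cderivable_shift f w z : cderivable f (w + z) ->
  cderivable (fun y => f (w + y)) z.
Proof.
move=> /derivable_cabsP[d Hd]; apply/derivable_cabsP; exists d => e e0.
by have [r r0 Hr] := Hd e e0; exists r => // h; rewrite addrA; exact: Hr.
Qed.

(** The frame between the two squares is cut into four rectangles: two strips of full width below
    and above, and two short ones at the sides. None contains 0, so Goursat's theorem removes
    each. *)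
Lemma contour_shrink f (e rho : R) : 0 < e -> e <= rho ->
  (forall z, in_rect (- rho) rho (- rho) rho z -> z != 0 -> cderivable f z) ->
  contour f (- rho) rho (- rho) rho = contour f (- e) e (- e) e.
Proof.
move=> e0 erho df.
have nz (x y : R) : x != 0 \/ y != 0 -> Complex x y != 0.
  by rewrite eq_complex /= negb_and => -[->//|->]; rewrite orbT.
have cf (x y : R) : - rho <= x <= rho -> - rho <= y <= rho -> x != 0 \/ y != 0 ->
    ccontinuous f (Complex x y).
  move=> hx hy xy; apply/cderivable_continuous/df; last exact: nz.
  by rewrite /in_rect /= hx hy.
have zero a b c d : - rho <= a -> a <= b -> b <= rho -> - rho <= c -> c <= d -> d <= rho ->
    0 < a \/ b < 0 \/ 0 < c \/ d < 0 -> contour f a b c d = 0.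
  move=> h1 h2 h3 h4 h5 h6 h; apply: goursat => // z.
  rewrite /in_rect => /andP[/andP[za zb] /andP[zc zd]]; apply: df.
    by rewrite /in_rect; apply/andP; split; lra.
  apply/eqP => z0; rewrite z0 /= in za zb zc zd; lra.
have ne : - e != 0 by rewrite oppr_eq0 gt_eqF.
have pe : e != 0 by rewrite gt_eqF.
have nr : - rho != 0 by rewrite oppr_eq0 gt_eqF//; lra.
have pr : rho != 0 by rewrite gt_eqF//; lra.
rewrite (@contour_splity _ f _ _ _ (- e)); try by lra.
- rewrite (@contour_splity _ f _ _ (- e) e); try by lra.
  + rewrite (@contour_splitx _ f _ (- e) _ (- e) e); try by lra.
    * rewrite (@contour_splitx _ f (- e) e rho); try by lra.
      -- rewrite (zero (- rho) rho (- rho) (- e)); try by lra.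
         rewrite (zero (- rho) (- e) (- e) e); try by lra.
         rewrite (zero e rho (- e) e); try by lra.
         rewrite (zero (- rho) rho e rho); try by lra.
      -- by move=> x hx; apply: cf; [lra|lra|right].
      -- by move=> x hx; apply: cf; [lra|lra|right].
    * by move=> x hx; apply: cf; [lra|lra|right].
    * by move=> x hx; apply: cf; [lra|lra|right].
  + by move=> x hx; apply: cf; [lra|lra|left].
  + by move=> x hx; apply: cf; [lra|lra|left].
- by move=> x hx; apply: cf; [lra|lra|left].
- by move=> x hx; apply: cf; [lra|lra|left].
Qed.

(** A crude form of Cauchy's formula at the centre; the constant is irrelevant because powers will
    absorb it. Bounding H where |z| >= rho covers the boundary of the square and is the form in
    which the perturbation on the annulus supplies its estimate. *)
Lemma square_quarter H (rho theta : R) : 0 < rho -> H 0 = 1 ->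
  (forall z, in_rect (- rho) rho (- rho) rho z -> cderivable H z) ->
  (forall z, in_rect (- rho) rho (- rho) rho z -> rho <= cabs z -> cabs (H z) <= theta) ->
  1 / 4 <= theta.
Proof.
move=> rho0 H0 dH Hth.
have in0 : in_rect (- rho) rho (- rho) rho 0 by rewrite /in_rect /= oppr_le0 ltW.
have /continuous_cabsP/(_ (1 / 4) ltac:(lra))[r r0 Hr] :=
  cderivable_continuous (dH 0 in0).
(* Points of the tiny square have modulus at most 2 e < r, so H is within 1/4 of 1 on it. *)
pose e := Num.min rho (r / 3).
have e0 : 0 < e by rewrite /e lt_min rho0; lra.
have erho : e <= rho by rewrite /e ge_min lexx.
have er : 2 * e < r.
  have : e <= r / 3 by rewrite /e ge_min lexx orbT.
  lra.
(* The factor i rotates the residue integral 2 pi i onto the real axis, where [contour] sees it. *)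
pose F z := Complex 0 1 * H z / z.
have dF z : in_rect (- rho) rho (- rho) rho z -> z != 0 -> cderivable F z.
  move=> /dH dHz z0.
  apply: (@cderivableM (fun z => Complex 0 1 * H z) (fun z => z^-1)).
    by apply: cderivableM; [exact: cderivable_cst|exact: dHz].
  exact: (@cderivableV (fun y => y) z z0 (@cderivable_id z)).
have ci : cabs (Complex 0 1 : R[i]) = 1 by rewrite /cabs /= expr0n expr1n add0r sqrtr1.
have cF d (x y : R) : 0 < d -> d <= rho -> - d <= x <= d -> - d <= y <= d ->
    (x == - d) || (x == d) || (y == - d) || (y == d) -> ccontinuous F (Complex x y).
  move=> d0 drho xd yd h; apply/cderivable_continuous/dF.
    by rewrite /in_rect /=; apply/andP; split; lra.
  rewrite eq_complex /=; apply/negP => /andP[/eqP x0 /eqP y0].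
  by move: h; rewrite x0 y0 eq_sym oppr_eq0 (eq_sym 0) gt_eqF.
have cF1 d (c : R) : 0 < d -> d <= rho -> (c == - d) || (c == d) ->
    ctn_on (- d) d (fun x => complex.Re (F (Complex x c))).
  move=> d0 drho cd; apply: ctn_on_Re => x hx; apply: (cF d) => //; last by rewrite -orbA cd orbT.
  by case/orP: cd => /eqP ->; lra.
have cF2 d (c : R) : 0 < d -> d <= rho -> (c == - d) || (c == d) ->
    ctn_on (- d) d (fun x => complex.Im (F (Complex c x))).
  move=> d0 drho cd; apply: ctn_on_Im => x hx; apply: (cF d) => //; last by rewrite cd.
  by case/orP: cd => /eqP ->; lra.
have cge d (x y : R) : 0 < d -> (x == - d) || (x == d) || (y == - d) || (y == d) ->
    d <= cabs (Complex x y).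
  move=> d0 h.
  have := normr_Re_le (Complex x y); have := normr_Im_le (Complex x y) => /= h1 h2.
  case/orP: h => [/orP[/orP[]|]|] /eqP E.
  - by move: h2; rewrite E normrN gtr0_norm.
  - by move: h2; rewrite E gtr0_norm.
  - by move: h1; rewrite E normrN gtr0_norm.
  - by move: h1; rewrite E gtr0_norm.
have outer (x y : R) : - rho <= x <= rho -> - rho <= y <= rho ->
    (x == - rho) || (x == rho) || (y == - rho) || (y == rho) ->
    cabs (F (Complex x y)) <= theta / rho.
  move=> hx hy h; have hc := cge _ _ _ rho0 h.
  rewrite /F cabs_div cabsM ci mul1r; apply: ler_pM; rewrite ?cabs_ge0 ?invr_ge0 ?cabs_ge0//.
    by apply: Hth => //; rewrite /in_rect /= hx hy.
  by rewrite lef_pV2 ?posrE//; exact: lt_le_trans hc.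
have outRe (x c : R) : (c == - rho) || (c == rho) -> - rho <= x <= rho ->
    `|complex.Re (F (Complex x c))| <= theta / rho.
  move=> cr hx; apply: le_trans (normr_Re_le _) _; apply: outer => //.
    by case/orP: cr => /eqP ->; lra.
  by rewrite -orbA cr orbT.
have outIm (y c : R) : (c == - rho) || (c == rho) -> - rho <= y <= rho ->
    `|complex.Im (F (Complex c y))| <= theta / rho.
  move=> cr hx; apply: le_trans (normr_Im_le _) _; apply: outer => //.
    by case/orP: cr => /eqP ->; lra.
  by rewrite cr.
have inner (x y : R) : - e <= x <= e -> - e <= y <= e ->
    (x == - e) || (x == e) || (y == - e) || (y == e) ->
    cabs (F (Complex x y) - Complex 0 1 / Complex x y) <= (4 * e)^-1.
  move=> hx hy h; have hc := cge _ _ _ e0 h.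
  rewrite /F -mulrBl -{2}[Complex 0 1]mulr1 -mulrBr cabs_div cabsM ci mul1r invfM.
  apply: ler_pM; rewrite ?cabs_ge0 ?invr_ge0 ?cabs_ge0//.
    rewrite -H0 -(add0r (Complex x y)) -[4^-1]mul1r; apply: Hr.
    apply: le_lt_trans er; apply: le_trans (cabs_le_ReIm _) _ => /=.
    have : `|x| <= e by rewrite ler_norml; lra.
    have : `|y| <= e by rewrite ler_norml; lra.
    lra.
  by rewrite lef_pV2 ?posrE//; exact: lt_le_trans hc.
have iz (x y : R) : Complex 0 1 / Complex x y =
    Complex (y / (x ^+ 2 + y ^+ 2)) (x / (x ^+ 2 + y ^+ 2)).
  by rewrite /=; simpc; congr Complex; rewrite ?mul0r ?mul1r ?add0r ?subr0 ?opprK.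
(* On the sides of the tiny square the relevant part of i/z has size at least 1/(2e). The error of H
   costs 1/(4e), so half of it survives with a fixed sign. *)
have frac (x : R) : - e <= x <= e -> (2 * e)^-1 <= e / (x ^+ 2 + e ^+ 2).
  move=> hx; have x2 : x ^+ 2 <= e ^+ 2 by nra.
  have e2 : 0 < e ^+ 2 by rewrite exprn_gt0.
  have p2 : 0 < x ^+ 2 + e ^+ 2 by rewrite ltr_wpDl ?sqr_ge0.
  rewrite ler_pdivlMr// mulrC ler_pdivrMr; last by lra.
  by rewrite expr2 in e2 x2 *; nra.
have half : (2 * e)^-1 - (4 * e)^-1 = (4 * e)^-1 by field; rewrite gt_eqF.
set m := (4 * e)^-1 in half inner.
have bot : itg (- e) e (fun x => complex.Re (F (Complex x (- e)))) <= - m * (e - - e).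
  apply: itg_le; [lra|by apply: cF1; rewrite ?eqxx|move=> x hx].
  have h := inner x (- e) hx ltac:(lra) ltac:(by rewrite eqxx orbT).
  have := le_trans (normr_Re_le _) h; rewrite ReB iz /= ler_norml sqrrN mulNr.
  by have := frac x hx; lra.
have top : m * (e - - e) <= itg (- e) e (fun x => complex.Re (F (Complex x e))).
  apply: itg_ge; [lra|by apply: cF1; rewrite ?eqxx ?orbT|move=> x hx].
  have h := inner x e hx ltac:(lra) ltac:(by rewrite eqxx !orbT).
  have := le_trans (normr_Re_le _) h; rewrite ReB iz /= ler_norml.
  by have := frac x hx; lra.
have lft : itg (- e) e (fun x => complex.Im (F (Complex (- e) x))) <= - m * (e - - e).
  apply: itg_le; [lra|by apply: cF2; rewrite ?eqxx|move=> x hx].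
  have h := inner (- e) x ltac:(lra) hx ltac:(by rewrite eqxx).
  have := le_trans (normr_Im_le _) h; rewrite ImB iz /= ler_norml sqrrN mulNr (addrC (e ^+ 2)).
  by have := frac x hx; lra.
have rgt : m * (e - - e) <= itg (- e) e (fun x => complex.Im (F (Complex e x))).
  apply: itg_ge; [lra|by apply: cF2; rewrite ?eqxx ?orbT|move=> x hx].
  have h := inner e x ltac:(lra) hx ltac:(by rewrite eqxx !orbT).
  have := le_trans (normr_Im_le _) h; rewrite ImB iz /= ler_norml (addrC (e ^+ 2)).
  by have := frac x hx; lra.
have me : m * (e - - e) = 1 / 2 by rewrite /m; field; rewrite gt_eqF.
have tr : theta / rho * (rho - - rho) = 2 * theta by field; rewrite gt_eqF.
have Bot : - (theta / rho) * (rho - - rho) <=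
    itg (- rho) rho (fun x => complex.Re (F (Complex x (- rho)))).
  apply: itg_ge; [lra|by apply: cF1; rewrite ?eqxx|move=> x hx].
  by have := outRe x (- rho) ltac:(by rewrite eqxx) hx; rewrite ler_norml => /andP[].
have Top : itg (- rho) rho (fun x => complex.Re (F (Complex x rho))) <=
    theta / rho * (rho - - rho).
  apply: itg_le; [lra|by apply: cF1; rewrite ?eqxx ?orbT|move=> x hx].
  by have := outRe x rho ltac:(by rewrite eqxx orbT) hx; rewrite ler_norml => /andP[].
have Lft : - (theta / rho) * (rho - - rho) <=
    itg (- rho) rho (fun x => complex.Im (F (Complex (- rho) x))).
  apply: itg_ge; [lra|by apply: cF2; rewrite ?eqxx|move=> x hx].
  by have := outIm x (- rho) ltac:(by rewrite eqxx) hx; rewrite ler_norml => /andP[].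
have Rgt : itg (- rho) rho (fun x => complex.Im (F (Complex rho x))) <=
    theta / rho * (rho - - rho).
  apply: itg_le; [lra|by apply: cF2; rewrite ?eqxx ?orbT|move=> x hx].
  by have := outIm x rho ltac:(by rewrite eqxx orbT) hx; rewrite ler_norml => /andP[].
(* The tiny contour is at most -4 * (1/2) = -2, the outer one at least -4 * 2 theta; hence 8 theta
   >= 2. *)
have := contour_shrink e0 erho dF.
rewrite /contour; rewrite !mulNr tr in Bot Top Lft Rgt; rewrite !mulNr me in bot top lft rgt.
lra.
Qed.

(** If the centre exceeded theta, the powers of f / f(z0) would be bounded on the outer part of the
    square by s^q with s < 1, which tends to 0 against the fixed bound 1/4. *)
Lemma square_max f (z0 : R[i]) (rho theta : R) : 0 < rho ->
  (forall z, in_rect (- rho) rho (- rho) rho z -> cderivable f (z0 + z)) ->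
  (forall z, in_rect (- rho) rho (- rho) rho z -> rho <= cabs z -> cabs (f (z0 + z)) <= theta) ->
  cabs (f z0) <= theta.
Proof.
move=> rho0 df fth; rewrite leNgt; apply/negP => lt.
have th0 : 0 <= theta.
  apply: le_trans (cabs_ge0 _) (fth (rho%:C)%C _ _).
    by rewrite /in_rect /=; apply/andP; split; lra.
  by rewrite cabs_real ler_norm.
have f0 : 0 < cabs (f z0) by exact: le_lt_trans lt.
have fn0 : f z0 != 0 by rewrite -cabs_gt0.
pose s := theta / cabs (f z0).
have s0 : 0 <= s by rewrite divr_ge0// ltW.
have s1 : s < 1 by rewrite ltr_pdivrMr// mul1r.
suff H q : 1 / 4 <= s ^+ q.
  have /cvgrPdist_lt/(_ (1 / 4) ltac:(lra)) : s ^+ n @[n --> \oo] --> 0.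
    by apply: cvg_expr; rewrite ger0_norm.
  move=> [N _ /(_ N (leqnn _))] /=; rewrite sub0r normrN ger0_norm ?exprn_ge0//.
  by have := H N; lra.
apply: (@square_quarter (fun z => (f (z0 + z) / f z0) ^+ q) rho _ rho0).
- by rewrite addr0 divff// expr1n.
- move=> z hz; apply: cderivableX.
  apply: cderivableM; last exact: cderivable_cst.
  by apply: cderivable_shift; exact: df.
- move=> z hz rz; rewrite cabsX cabs_div lerXn2r ?nnegrE ?divr_ge0 ?cabs_ge0//.
  by rewrite ler_pM2r ?invr_gt0//; exact: fth.
Qed.

End MaximumPrinciple.

(** * Maximum principle on annuli *)

Section Annulus.
Variable R : realType.
Implicit Types (g : R[i] -> R[i]).

Lemma continuous_cabs_pair g (p : R * R) : ccontinuous g (Complex p.1 p.2) ->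
  {for p, continuous (fun q : R * R => cabs (g (Complex q.1 q.2)))}.
Proof.
move=> /continuous_cabsP cg.
apply/(@cvgrPdist_le _ R^o _ _ (nbhs_filter (p : R * R))) => e e0.
have [r r0 H] := cg e e0; apply/nbhs_ballP; exists (r / 2) => /=; first by rewrite divr_gt0.
move=> q [] /=; rewrite /ball /= => h1 h2.
have := H (Complex q.1 q.2 - Complex p.1 p.2); rewrite subrKC.
have -> : cabs (Complex q.1 q.2 - Complex p.1 p.2) < r.
  apply: le_lt_trans (cabs_le_ReIm _) _; rewrite ReB ImB /=.
  by rewrite distrC (distrC q.2); lra.
move=> /(_ isT); apply: le_trans; rewrite ler_norml; apply/andP; split.
  have := lerB_cabs (g (Complex p.1 p.2)) (g (Complex q.1 q.2) - g (Complex p.1 p.2)).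
  have := ler_cabsD (g (Complex p.1 p.2)) (g (Complex q.1 q.2) - g (Complex p.1 p.2)).
  by rewrite subrKC; lra.
have := lerB_cabs (g (Complex p.1 p.2)) (g (Complex q.1 q.2) - g (Complex p.1 p.2)).
by rewrite subrKC; lra.
Qed.

Lemma compact_annulus (r1 r2 : R) : 0 <= r2 ->
  compact [set p : R * R | r1 <= p.1 ^+ 2 + p.2 ^+ 2 <= r2 ^+ 2].
Proof.
move=> r20.
have sq_cont : continuous (fun p : R * R => p.1 ^+ 2 + p.2 ^+ 2).
  by move=> p; apply: cvgD; apply: (@continuous_comp _ _ _ _ (fun x : R => x ^+ 2));
    [exact: cvg_fst|exact: exprn_continuous|exact: cvg_snd|exact: exprn_continuous].
apply: (@subclosed_compact _ _ (`[- r2, r2] `*` `[- r2, r2])).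
- rewrite [X in closed X](_ : _ = (fun p : R * R => p.1 ^+ 2 + p.2 ^+ 2) @^-1` `[r1, r2 ^+ 2]).
    by apply: closed_comp => [p _|]; [exact: sq_cont|exact: itv_closed].
  by apply/seteqP; split=> p /=; rewrite in_itv.
- by apply: compact_setX; exact: segment_compact.
- have sq (x : R) : x ^+ 2 <= r2 ^+ 2 -> x \in `[- r2, r2].
    by move=> hx; rewrite in_itv /= -ler_norml -(@ler_pXn2r _ 2) ?nnegrE// real_normK ?num_real.
  move=> p /= /andP[_ h]; split; apply: sq; apply: le_trans h.
    by rewrite lerDl sqr_ge0.
  by rewrite lerDr sqr_ge0.
Qed.

(* The weight 1 + delta |z|^2 pushes maximisers off the boundary, and its
   strict subharmonicity makes an interior maximiser of the weighted modulus a
   strict local maximum of the modulus of g (1 + a (z - zs)). *)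
Lemma annulus_max g (r1 r2 m : R) (z1 : R[i]) : 0 < r1 -> r2 <= 1 ->
  (forall z, r1 <= cabs z <= r2 -> cderivable g z) ->
  (forall z, cabs z = r1 \/ cabs z = r2 -> cabs (g z) <= m) ->
  r1 <= cabs z1 <= r2 -> cabs (g z1) <= m.
Proof.
move=> r10 r21 dg gm hz1.
have r20 : 0 < r2 by lra.
have m0 : 0 <= m.
  apply: le_trans (cabs_ge0 _) (gm (r1%:C)%C _); left.
  by rewrite cabs_real gtr0_norm.
rewrite leNgt; apply/negP => mlt.
pose G := cabs (g z1) ^+ 2.
have mG : m ^+ 2 < G by rewrite ltr_pXn2r ?nnegrE ?cabs_ge0.
have m20 : 0 <= m ^+ 2 by rewrite sqr_ge0.
(* Small enough that m^2 (1 + delta) < G: as |z| <= r2 <= 1, the weighted square then stays below G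
   on both circles. The bound delta <= 1 keeps the weight at most 2. *)
pose delta := Num.min 1 ((G - m ^+ 2) / (2 * (m ^+ 2 + 1))).
have d0 : 0 < delta by rewrite /delta lt_min ltr01 divr_gt0//; lra.
have d1 : delta <= 1 by rewrite /delta ge_min lexx.
have mdG : m ^+ 2 * (1 + delta) < G.
  have : delta <= (G - m ^+ 2) / (2 * (m ^+ 2 + 1)) by rewrite /delta ge_min lexx orbT.
  rewrite ler_pdivlMr; last by lra.
  by nra.
pose K := [set p : R * R | r1 ^+ 2 <= p.1 ^+ 2 + p.2 ^+ 2 <= r2 ^+ 2].
have KP p : K p <-> r1 <= cabs (Complex p.1 p.2) <= r2.
  have -> : K p = (r1 ^+ 2 <= p.1 ^+ 2 + p.2 ^+ 2 <= r2 ^+ 2) :> Prop by [].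
  have -> : p.1 ^+ 2 + p.2 ^+ 2 = cabs (Complex p.1 p.2) ^+ 2 by rewrite sqr_cabs.
  by rewrite !ler_pXn2r ?nnegrE ?cabs_ge0 ?(ltW r10) ?(ltW r20)//; split.
pose phi (p : R * R) := cabs (g (Complex p.1 p.2)) ^+ 2 * (1 + delta * (p.1 ^+ 2 + p.2 ^+ 2)).
have Kz1 : K (complex.Re z1, complex.Im z1) by apply/KP; case: (z1) hz1.
have [|||ps] := @compact_EVT_max _ R phi K.
- by exists (complex.Re z1, complex.Im z1).
- by apply: compact_annulus; exact: ltW.
- apply: continuous_in_subspaceT => p; rewrite inE => /KP Kp.
  apply: cvgM.
    apply: (@continuous_comp _ _ _ _ (fun x : R => x ^+ 2)); last exact: exprn_continuous.
    by apply: continuous_cabs_pair; apply: cderivable_continuous; exact: dg.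
  apply: cvgD; first exact: cvg_cst.
  apply: cvgM; first exact: cvg_cst.
  by apply: cvgD; apply: (@continuous_comp _ _ _ _ (fun x : R => x ^+ 2));
    [exact: cvg_fst|exact: exprn_continuous|exact: cvg_snd|exact: exprn_continuous].
rewrite inE => /KP Kps phimax.
pose zs := Complex ps.1 ps.2; pose A := 1 + delta * cabs zs ^+ 2.
have maxz z : r1 <= cabs z <= r2 ->
    cabs (g z) ^+ 2 * (1 + delta * cabs z ^+ 2) <= cabs (g zs) ^+ 2 * A.
  case: z => x y hz; have := phimax (x, y).
  rewrite inE => /(_ ((KP (x, y)).2 hz)).
  by rewrite /A /zs (sqr_cabs (Complex x y)) (sqr_cabs (Complex ps.1 ps.2)).
have sq_le z : cabs z <= r2 -> cabs z ^+ 2 <= 1.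
  by move=> h; rewrite expr_le1 ?cabs_ge0//; lra.
have A1 : 1 <= A by rewrite lerDl mulr_ge0 ?sqr_ge0// ltW.
have A2 : A <= 2.
  by have := sq_le zs; case/andP: Kps => _ -> /(_ isT); rewrite /A; have := sqr_ge0 (cabs zs); nra.
have GA : G <= cabs (g zs) ^+ 2 * A.
  apply: le_trans (maxz _ hz1); rewrite ler_peMr ?sqr_ge0//.
  by rewrite lerDl mulr_ge0 ?sqr_ge0// ltW.
have notbd : cabs zs = r1 \/ cabs zs = r2 -> False.
  move=> bd; have gz := gm _ bd.
  have : cabs (g zs) ^+ 2 * A <= m ^+ 2 * (1 + delta).
    apply: ler_pM; rewrite ?sqr_ge0//; first by lra.
      by rewrite ler_pXn2r ?nnegrE ?cabs_ge0.
    rewrite lerD2l -[leRHS]mulr1 ler_pM2l//.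
    by apply: sq_le; case/andP: Kps.
  lra.
case/andP: Kps; rewrite -/zs !le_eqVlt => /orP[/eqP b1|lt1].
  by exfalso; apply: notbd; left.
move=> /orP[/eqP b2|lt2]; first by apply: notbd; right.
(* Points of the square of half-side rho have modulus at most 2 rho, so its translate to zs stays in
   the annulus. *)
pose rho := Num.min (cabs zs - r1) (r2 - cabs zs) / 2.
have rho0 : 0 < rho by rewrite divr_gt0// lt_min !subr_gt0 lt1.
have rh1 : 2 * rho <= cabs zs - r1.
  by rewrite /rho mulrC divfK// ge_min lexx.
have rh2 : 2 * rho <= r2 - cabs zs.
  by rewrite /rho mulrC divfK// ge_min lexx orbT.
have inK z : in_rect (- rho) rho (- rho) rho z -> r1 <= cabs (zs + z) <= r2.
  move=> /andP[h1 h2].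
  have : cabs z <= 2 * rho.
    apply: le_trans (cabs_le_ReIm _) _.
    by move: h1 h2; rewrite -!ler_norml; lra.
  have := lerB_cabs zs z; have := ler_cabsD zs z; lra.
pose k := delta * rho ^+ 2 / 4.
have rho2 : 0 < rho ^+ 2 by rewrite exprn_gt0.
have k0 : 0 < k by rewrite /k; nra.
have k1 : k <= 1.
  have : rho ^+ 2 <= 1 by rewrite expr_le1 ?ltW//; lra.
  by rewrite /k; nra.
(* a is delta times the conjugate of zs, divided by A. With this choice |1 + a z|^2 agrees to first
   order in z with the ratio of the weights at zs + z and at zs. *)
pose a := Complex (delta * ps.1 / A) (- (delta * ps.2 / A)).
pose H y := g y * (1 + a * (y - zs)).
have Hzs : H zs = g zs by rewrite /H subrr mulr0 addr0 mulr1.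
have gs0 : 0 < cabs (g zs).
  rewrite lt0r cabs_ge0 andbT; apply/eqP => E.
  by move: GA; rewrite E expr0n mul0r; lra.
suff : cabs (H zs) <= cabs (g zs) * (1 - k / 2).
  by rewrite Hzs; nra.
apply: (@square_max _ H zs rho _ rho0).
  move=> z hz; apply: cderivableM; first by apply: dg; exact: inK.
  apply: cderivableD; first exact: cderivable_cst.
  apply: cderivableM; first exact: cderivable_cst.
  by apply: cderivableD; [exact: cderivable_id|exact: cderivable_cst].
move=> z hz rz; have hK := inK z hz; have hmax := maxz _ hK.
have r2z : rho ^+ 2 <= cabs z ^+ 2 by rewrite ler_pXn2r ?nnegrE ?cabs_ge0// ltW.
set E := 1 + delta * cabs (zs + z) ^+ 2 in hmax.
have E1 : 1 <= E by rewrite lerDl mulr_ge0 ?sqr_ge0// ltW.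
have E2 : E <= 2.
  have := sq_le (zs + z); case/andP: hK => _ -> /(_ isT).
  by rewrite /E; have := sqr_ge0 (cabs (zs + z)); nra.
(* The linear terms cancel and the quadratic ones leave delta |z|^2 (1 - delta |zs|^2 / A), where A
   - delta |zs|^2 = 1. Since A and E are at most 2, this loss is at least k E when |z| >= rho; this
   is where k comes from. *)
have key : A * cabs (1 + a * z) ^+ 2 = E - delta / A * cabs z ^+ 2.
  rewrite /E !sqr_cabs; case: (z) => s t.
  have -> : 1 + a * Complex s t = Complex (1 + (delta * ps.1 / A * s + delta * ps.2 / A * t))
      (delta * ps.1 / A * t - delta * ps.2 / A * s).
    by rewrite /a; simpc; congr Complex; ring.
  have AE : A = 1 + delta * (ps.1 ^+ 2 + ps.2 ^+ 2) by rewrite /A sqr_cabs.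
  have A0 : A != 0 by rewrite gt_eqF//; lra.
  rewrite /=.
  have -> : 1 + delta * ((ps.1 + s) ^+ 2 + (ps.2 + t) ^+ 2) = A + delta * (2 * (ps.1 * s + ps.2 * t) + (s ^+ 2 + t ^+ 2)).
    by rewrite AE; ring.
  have -> : delta / A * (s ^+ 2 + t ^+ 2) = delta * (s ^+ 2 + t ^+ 2) -
      delta * (ps.1 ^+ 2 + ps.2 ^+ 2) * (delta / A) * (s ^+ 2 + t ^+ 2).
    have -> : delta * (ps.1 ^+ 2 + ps.2 ^+ 2) = A - 1 by rewrite AE; ring.
    by field.
  by field.
rewrite -(@ler_pXn2r _ 2) ?nnegrE ?cabs_ge0 ?mulr_ge0 ?cabs_ge0//; last by lra.
rewrite /H (addrC zs) addrK cabsM !exprMn.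
set N := cabs (1 + a * z) ^+ 2 in key *.
have N0 : 0 <= N by exact: sqr_ge0.
set g1 := cabs (g (z + zs)) ^+ 2; set g0 := cabs (g zs) ^+ 2 in hmax *.
have g10 : 0 <= g1 by exact: sqr_ge0.
have g00 : 0 <= g0 by exact: sqr_ge0.
have {}hmax : g1 * E <= g0 * A by rewrite /g1 (addrC z).
have kE : k * E <= delta / A * cabs z ^+ 2.
  apply: (@le_trans _ _ (delta / 2 * rho ^+ 2)); first by rewrite /k; have := mulr_ge0 (ltW d0) (ltW rho2); clear -E2; nra.
  apply: ler_pM => //; [by lra|by exact: ltW|].
  by rewrite ler_pM2l// lef_pV2 ?posrE; lra.
have : g1 * N * E <= g0 * (1 - k / 2) ^+ 2 * E.
  apply: (@le_trans _ _ (g0 * (A * N))).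
    by have := ler_wpM2r N0 hmax; lra.
  have kk : E - delta / A * cabs z ^+ 2 <= (1 - k / 2) ^+ 2 * E by clear -kE E1 k0; nra.
  by rewrite key -[leRHS]mulrA; exact: ler_wpM2l.
by rewrite ler_pM2r//; lra.
Qed.

End Annulus.

(** * Three circles and monomial minorants *)

Section MonomialMinorant.
Variable R : realType.
Implicit Types (f : R[i] -> R[i]) (v : R -> R).

(** Hadamard's theorem for integer exponents, where f / z^n is single-valued on the annulus and the
    maximum principle applies to it directly. The two hypotheses say that |f(t)| / t^n exceeds the
    bounds which v gives on the two circles. *)
Lemma three_circles f v (n : nat) (r1 t r2 : R) :
  (forall r, 0 <= r -> r < 1 -> 0 < v r) -> holo_disc f -> vbounded v f 1 ->
  0 < r1 -> r1 < t -> t < r2 -> r2 < 1 ->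
  t ^+ n < cabs (f (t%:C)%C) * v r1 * r1 ^+ n ->
  t ^+ n < cabs (f (t%:C)%C) * v r2 * r2 ^+ n -> False.
Proof.
move=> vpos /holo_discP df fv r10 r1t tr2 r21 h1 h2.
have v1 := vpos r1 ltac:(lra) ltac:(lra); have v2 := vpos r2 ltac:(lra) ltac:(lra).
set B := cabs _ in h1 h2.
have pos (r : R) : 0 < r -> 0 < r ^+ n by exact: exprn_gt0.
have p1 := pos _ r10; have p2 : 0 < r2 ^+ n by apply: pos; lra.
have pt : 0 < t ^+ n by apply: pos; lra.
pose m := Num.max (v r1 * r1 ^+ n)^-1 (v r2 * r2 ^+ n)^-1.
have mlt : m < B / t ^+ n.
  have inv (x : R) : 0 < x -> t ^+ n < B * x -> x^-1 < B / t ^+ n.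
    by move=> x0 h; rewrite ltr_pdivlMr// mulrC ltr_pdivrMr.
  by rewrite gt_max !inv ?mulr_gt0// mulrA.
suff : cabs (f (t%:C)%C / (t%:C)%C ^+ n) <= m.
  by rewrite cabs_div cabsX cabs_real gtr0_norm -/B; lra.
apply: (@annulus_max _ (fun z => f z / z ^+ n) r1 r2) => //.
- lra.
- move=> z hz; have z0 : z != 0 by rewrite -cabs_gt0; lra.
  apply: cderivableM; first by apply: df; rewrite /disc; lra.
  apply: (@cderivableV _ (fun z => z ^+ n)); first by rewrite expf_neq0.
  by apply: (@cderivableX _ (fun z => z)); exact: cderivable_id.
- have bd z : disc z -> 0 < cabs z -> cabs (f z / z ^+ n) <= (v (cabs z) * cabs z ^+ n)^-1.
    move=> dz z0; have := fv z dz; rewrite cabs_div cabsX invfM => h.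
    have vz : 0 < v (cabs z) by apply: vpos => //; exact: ltW.
    by apply: ler_wpM2r; rewrite ?invr_ge0 ?exprn_ge0 ?cabs_ge0// -[leRHS]mul1r ler_pdivlMr// mulrC.
  move=> z [] E; apply: le_trans (bd z _ _) _; rewrite /disc ?E; try by lra.
    by rewrite le_max lexx.
  by rewrite le_max lexx orbT.
- by rewrite cabs_real gtr0_norm; lra.
Qed.

(** The monomial plays the role of a supporting line of log(1/v) as a function of log r. The factor
    t in the last equation is the price of an integer slope. *)
Lemma monomial_minorant f v (t : R) :
  (forall r, 0 <= r -> r < 1 -> 0 < v r) ->
  (forall r s, 0 <= r -> r <= s -> s < 1 -> v s <= v r) ->
  holo_disc f -> vbounded v f 1 -> 0 < t -> t < 1 -> 0 < cabs (f (t%:C)%C) ->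
  exists a n, [/\ 0 < a, (forall r, 0 <= r -> r < 1 -> v r * (a * r ^+ n.+1) <= 1) &
    a * t ^+ n.+1 = t * cabs (f (t%:C)%C)].
Proof.
move=> vpos vmono hf fv t0 t1 B0; have circ := three_circles vpos hf fv.
have fvt : v t * cabs (f (t%:C)%C) <= 1.
  by have := fv (t%:C)%C; rewrite /disc cabs_real gtr0_norm //; apply.
set B := cabs _ in circ B0 fvt *.
(* With B = |f(t)|, [L n] and [U n] say that B (r/t)^n exceeds 1/v at some r to the left,
   respectively right, of t. Three circles forbids both for the same n. *)
pose L n := exists r, [/\ 0 < r, r < t & t ^+ n < B * v r * r ^+ n].
pose U n := exists r, [/\ t < r, r < 1 & t ^+ n < B * v r * r ^+ n].
have LU n : L n -> ~ U n.
  move=> [r1 [r10 r1t h1]] [r2 [tr2 r21 h2]].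
  exact: (circ n r1 t r2).
(* For large n the monomial is too steep to the right of t, so [U n] holds and excludes [L n]. *)
have exL : exists n, `[< ~ L n.+1 >].
  pose r := (t + 1) / 2.
  have rt : t < r by rewrite /r; lra.
  have r1 : r < 1 by rewrite /r; lra.
  have vr := vpos r ltac:(lra) r1.
  have s0 : 0 < t / r by rewrite divr_gt0//; lra.
  have s1 : t / r < 1 by rewrite ltr_pdivrMr; lra.
  have /cvgrPdist_lt/(_ (B * v r) (mulr_gt0 B0 vr)) : (t / r) ^+ n @[n --> \oo] --> 0.
    by apply: cvg_expr; rewrite gtr0_norm.
  move=> [N _ /(_ N.+1 (leqnSn _))] /=; rewrite sub0r normrN gtr0_norm ?exprn_gt0//.
  rewrite expr_div_n ltr_pdivrMr ?exprn_gt0; try by lra.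
  by move=> h; exists N; apply/asboolP => /LU; apply; exists r.
case: (ex_minnP exL) => m /asboolP nL mmin.
(* If m > 0, minimality gives [L m]. If m = 0, [U 0] would mean 1 < B v(r) for some r > t, although
   B v(r) <= B v(t) <= 1. *)
have nU : ~ U m.
  case: (m) mmin => [|k] mmin; last first.
    by apply: LU; apply: contrapT => nLk; have := mmin k; rewrite ltnn => /(_ (introT (asboolP _) nLk)).
  move=> [r [tr r1]]; rewrite !expr0 mulr1 => h.
  by have := vmono t r (ltW t0) (ltW tr) r1; nra.
have tm : 0 < t ^+ m by rewrite exprn_gt0.
(* Slope m is safe on the right of t and slope m + 1 on the left. The monomial equals r * B (r/t)^m
   and also t * B (r/t)^(m+1), with prefactors below 1, so it is safe on both sides. *)
exists (B / t ^+ m), m.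
split; [by rewrite divr_gt0| |by rewrite exprS mulrCA divfK ?gt_eqF].
move=> r; rewrite le_eqVlt => /orP[/eqP <- _|r0 r1]; first by rewrite expr0n /= !mulr0.
have vr := vpos r (ltW r0) r1.
have -> : v r * (B / t ^+ m * r ^+ m.+1) = B * v r * r ^+ m * r / t ^+ m.
  by rewrite exprS; ring.
rewrite ler_pdivrMr// mul1r.
case: (ltgtP r t) => [rt|tr|->].
- apply: (@le_trans _ _ (t ^+ m.+1)).
    rewrite leNgt; apply/negP => h; apply: nL; exists r; split => //.
    by move: h; rewrite [r ^+ m.+1]exprSr mulrA.
  by rewrite exprS ler_piMl// ltW.
- have h : B * v r * r ^+ m <= t ^+ m.
    by rewrite leNgt; apply/negP => h; apply: nU; exists r.
  have : 0 <= B * v r * r ^+ m by rewrite !mulr_ge0 ?exprn_ge0// ltW.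
  nra.
- have : B * v t * t <= 1 by nra.
  by nra.
Qed.

End MonomialMinorant.

(** * Greedy selection of monomials *)

Section GreedySelection.
Variables (R : realType) (u : R -> R) (a : nat -> R) (d : nat -> nat) (T : nat -> R).
Variables (c : R) (N : nat).
Hypotheses (u_gt0 : forall r, 0 < r -> r < 1 -> 0 < u r).
Hypotheses (a_gt0 : forall k, 0 < a k).
Hypotheses (T_gt0 : forall k, 0 < T k) (T_lt1 : forall k, T k < 1).
Hypotheses (T_incr : forall i j, (i < j)%N -> T i < T j).
Hypotheses (c_gt0 : 0 < c) (c_le1 : c <= 1).

Let l k r := a k * r ^+ d k.
Hypotheses (l_le : forall k r, 0 < r -> r < 1 -> l k r <= u r).
Hypotheses (l_ge : forall k, c * u (T k) <= l k (T k)).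

(** eta = kappa * c^2: [linkedP] spends one c in comparing with the line of the unserved point and
    one in passing to a chosen line. The remaining kappa = c / 2 is below c, as the decay lemmas
    need, and at most 1/2, as geometric summation needs. *)
Let eta := c ^+ 3 / 2.
Let kappa := c / 2.

Let l_gt0 k r : 0 < r -> 0 < l k r.
Proof. by move=> r0; rewrite mulr_gt0// exprn_gt0. Qed.

Let T_le i j : (i <= j)%N -> T i <= T j.
Proof. by rewrite leq_eqVlt => /orP[/eqP->//|/T_incr/ltW]. Qed.

Let l_scale k x t : 0 < x -> l k t = l k x * (t / x) ^+ d k.
Proof.
by move=> x0; rewrite /l -mulrA -exprMn (mulrC x) divfK ?gt_eqF.
Qed.

Let ratio_right i j x t (K : R) : 0 < x -> x <= t -> 0 <= K -> (d i <= d j)%N ->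
  l i x <= K * l j x -> l i t <= K * l j t.
Proof.
move=> x0 xt K0 dij h; rewrite (l_scale i t x0) (l_scale j t x0) mulrA.
have tx : 1 <= t / x by rewrite ler_pdivlMr// mul1r.
apply: ler_pM => //; first exact: ltW (l_gt0 _ x0).
  by rewrite exprn_ge0//; lra.
by rewrite ler_weXn2l.
Qed.

Let ratio_left i j x t (K : R) : 0 < t -> t <= x -> 0 <= K -> (d j <= d i)%N ->
  l i x <= K * l j x -> l i t <= K * l j t.
Proof.
move=> t0 tx K0 dij h; have x0 : 0 < x by lra.
rewrite (l_scale i t x0) (l_scale j t x0) mulrA.
have tx1 : t / x <= 1 by rewrite ler_pdivrMr// mul1r.
have tx0 : 0 < t / x by rewrite divr_gt0.
apply: ler_pM => //; first exact: ltW (l_gt0 _ x0).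
  by rewrite exprn_ge0//; lra.
by rewrite ler_wiXn2l// ltW.
Qed.

(** The ratio l i / l j is a power of the variable. It is at least c at y and at most K < c at x >=
    y, so it cannot be increasing and stays below K to the right of x. *)
Let decay_right i j x y t (K : R) : 0 < y -> y <= x -> x <= t -> 0 <= K -> K < c ->
  c * l j y <= l i y -> l i x <= K * l j x -> l i t <= K * l j t.
Proof.
move=> y0 yx xt K0 Kc hy hx; have x0 : 0 < x by lra.
case: (leqP (d i) (d j)) => [dij|/ltnW dji].
  exact: (ratio_right x0 xt K0 dij hx).
have h : l j y <= c^-1 * l i y by rewrite ler_pdivlMl.
have := ratio_right y0 yx (ltW (eqbRL (invr_gt0 c) c_gt0)) dji h.
rewrite ler_pdivlMl// => hx2; have := l_gt0 j x0; nra.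
Qed.

Let decay_left i j x y t (K : R) : 0 < t -> t <= x -> x <= y -> 0 <= K -> K < c ->
  c * l j y <= l i y -> l i x <= K * l j x -> l i t <= K * l j t.
Proof.
move=> t0 tx xy K0 Kc hy hx; have x0 : 0 < x by lra.
case: (leqP (d j) (d i)) => [dji|/ltnW dij].
  exact: (ratio_left t0 tx K0 dji hx).
have := ratio_right x0 xy K0 dij hx => hy2.
by have := l_gt0 j (lt_le_trans x0 xy); nra.
Qed.

Let between i j x y t (K : R) : 0 < x -> x <= t -> t <= y -> 0 < K ->
  K * l j x <= l i x -> K * l j y <= l i y -> K * l j t <= l i t.
Proof.
move=> x0 xt ty K0.
have E s : (K * l j s <= l i s) = (l j s <= K^-1 * l i s) by rewrite ler_pdivlMl.
rewrite !E => hx hy.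
have iK : 0 <= K^-1 by rewrite invr_ge0 ltW.
case: (leqP (d j) (d i)) => [dji|/ltnW dij].
  exact: (ratio_right x0 xt iK dji hx).
by apply: (ratio_left _ ty iK dij hy); lra.
Qed.

(** To the right, q is dominated by its successor. To the left, only the indices beyond the
    successor are controlled, and all of them, since the rest of the chain is built independently of
    q. *)
Let linked q q' := [/\ (q < q' <= N)%N,
  (forall t, T q' <= t -> t < 1 -> l q t <= kappa * l q' t) &
  (forall q'' t, (q' < q'' <= N)%N -> 0 < t -> t <= T q -> l q'' t <= kappa * l q t)].

Let Fixpoint chain (q : nat) (s : seq nat) {struct s} : Prop :=
  if s is q' :: s' then linked q q' /\ chain q' s' else True.

Let c3 : 0 < c ^+ 3. Proof. by rewrite exprn_gt0. Qed.
Let eta_gt0 : 0 < eta. Proof. by rewrite divr_gt0. Qed.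
Let kappaE : eta = kappa * c ^+ 2. Proof. by rewrite /eta /kappa; ring. Qed.
Let kappa_gt0 : 0 < kappa. Proof. by rewrite divr_gt0. Qed.
Let kappa_le : kappa <= 1 / 2. Proof. by have := c_le1; have := c_gt0; rewrite /kappa; lra. Qed.
Let kappa_lt : kappa < c. Proof. by have := c_le1; have := c_gt0; rewrite /kappa; lra. Qed.
Let eta_le : eta <= c.
Proof.
have c2 : c ^+ 2 <= 1 by rewrite expr_le1// ltW.
by have := c_gt0; rewrite /eta exprS; nra.
Qed.

Let serves q p := eta * u (T p) <= l q (T p).

(** Since p' is served neither by q nor by any k > q', their lines are at most kappa * c times that
    of p' at [T p'], while they dominate c times it at their own points. Decay carries this to
    [T q'], respectively [T q]. There l p' <= u, and c u is below the chosen line, which replaces p'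
    by the chosen index; a second decay extends the estimate to the whole range. *)
Let linkedP q p' q' : (q < p')%N -> (p' <= q')%N -> (q' <= N)%N -> ~ serves q p' ->
  (forall k, (q' < k <= N)%N -> ~ serves k p') -> linked q q'.
Proof.
have kc0 : 0 <= kappa * c by rewrite mulr_ge0// ltW.
have kcc : kappa * c < c by have := kappa_le; have := c_gt0; nra.
have unserved k p t : ~ serves k p -> 0 < t -> t < 1 ->
    l k t <= kappa * c * l p t -> l k t <= kappa * c * u t.
  move=> _ t0 t1 /le_trans; apply; rewrite ler_wpM2l//; exact: l_le.
have low k p : ~ serves k p -> l k (T p) <= kappa * c * l p (T p).
  move=> /negP; rewrite -ltNge => /ltW /le_trans; apply.
  have -> : eta * u (T p) = kappa * c * (c * u (T p)) by rewrite kappaE; ring.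
  exact: ler_wpM2l.
have up k t : 0 < t -> t < 1 -> forall j, t = T j -> l k t <= kappa * c * u t ->
    l k t <= kappa * l j t.
  move=> t0 t1 j tj /le_trans; apply; rewrite -mulrA tj; apply: ler_wpM2l; [exact: ltW|exact: l_ge].
have cl i j t : t = T i -> c * l j t <= l i t.
  by move=> ->; apply: le_trans (l_ge i); apply: ler_wpM2l; [exact: ltW|exact: l_le].
move=> qp' p'q' q'N nq nmax; have qq' : (q < q')%N by exact: leq_trans p'q'.
split; first by rewrite qq'.
  move=> t tq' t1.
  have h : l q (T q') <= kappa * c * l p' (T q').
    apply: (@decay_right q p' (T p') (T q)) => //; last 2 first.
    - exact: cl.
    - exact: low.
    - exact/ltW/T_incr.
    - exact: T_le.
  apply: (@decay_right q q' (T q') (T q)) => //; first exact/ltW/T_incr.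
  - exact: ltW.
  - exact: cl.
  apply: up => //; exact: (unserved _ p').
move=> k t /andP[q'k kN] t0 tq.
have nk : ~ serves k p' by apply: nmax; rewrite q'k.
have Tk x : (x <= q')%N -> T x <= T k by move=> h; apply/ltW/T_incr; exact: leq_ltn_trans q'k.
have h : l k (T q) <= kappa * c * l p' (T q).
  apply: (@decay_left k p' (T p') (T k)) => //; last 2 first.
  - exact: cl.
  - exact: low.
  - exact/ltW/T_incr.
  - exact: Tk.
apply: (@decay_left k q (T q) (T k)) => //; first exact/Tk/ltnW.
- exact: ltW.
- exact: cl.
apply: up => //; exact: (unserved _ p').
Qed.

(** Links compare indices two steps apart, so the sum splits into two interleaved geometric series
    of ratio at most 1/2, one led by q and one by its successor. *)
Let tail_sum q s t : chain q s -> 0 < t -> t <= T q ->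
  \sum_(k <- q :: s) l k t <= 2 * (l q t + if s is q' :: _ then l q' t else 0).
Proof.
move=> + t0; elim: s q => [|q' s IH] q /=.
  by move=> _ _; rewrite big_seq1 addr0; have := l_gt0 q t0; lra.
move=> [[/andP[qq' q'N] _ D2] ch] tq; rewrite big_cons.
have := IH q' ch (le_trans tq (ltW (T_incr qq'))).
have := l_gt0 q t0; have := l_gt0 q' t0.
case: s IH ch => [|q'' s] IH ch; first by lra.
have [[h _ _] _] := ch; have := D2 _ _ h t0 tq.
by have := kappa_le; have := l_gt0 q t0; nra.
Qed.

(** Subtracting l q t makes the induction close: when t is beyond [T q'], 2 l q <= l q' pays for the
    new term. Otherwise the tail estimate leaves 2 (l q + l q' + l q'') <= 6 u, the origin of the
    6. *)
Let head_sum q s t : chain q s -> T q <= t -> t < 1 ->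
  \sum_(k <- q :: s) l k t <= 6 * u t - l q t.
Proof.
move=> + + t1; elim: s q => [|q' s IH] q /=.
  move=> _ tq; have t0 := lt_le_trans (T_gt0 q) tq.
  by rewrite big_seq1; have := l_le q t0 t1; have := u_gt0 t0 t1; lra.
move=> [[_ D1 _] ch] tq; have t0 := lt_le_trans (T_gt0 q) tq; rewrite big_cons.
have lq := l_le q t0 t1; have lq' := l_le q' t0 t1; have ut := u_gt0 t0 t1.
case: (leP (T q') t) => tq'.
  have := IH q' ch tq'; have := D1 t tq' t1; have := l_gt0 q' t0.
  by have := kappa_le; nra.
have := tail_sum ch t0 (ltW tq').
case: (s) => [|q'' s']; first by lra.
by have := l_le q'' t0 t1; lra.
Qed.

Let chain_sum q s t : chain q s -> 0 < t -> t < 1 -> \sum_(k <- q :: s) l k t <= 6 * u t.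
Proof.
move=> ch t0 t1; case: (leP (T q) t) => tq.
  by apply: le_trans (head_sum ch tq t1) _; rewrite gerBl; exact/ltW/l_gt0.
apply: le_trans (tail_sum ch t0 (ltW tq)) _.
have := l_le q t0 t1; have := u_gt0 t0 t1.
case: (s) => [|q' s']; first by lra.
by have := l_le q' t0 t1; lra.
Qed.

(* q is the furthest line serving p, and the next one is chosen from the first
   index beyond q that q fails to serve. *)
Let greedy_chain p : (p <= N)%N -> exists q s,
  [/\ (p <= q <= N)%N, (forall k, (q < k <= N)%N -> ~ serves k p), chain q s &
   forall i, (p <= i <= N)%N -> exists2 k, k \in q :: s & eta * c * u (T i) <= l k (T i)].
Proof.
have [m] := ubnP (N - p)%N; elim: m p => // m IH p; rewrite ltnS => hm pN.
have exq : exists q, (p <= q <= N)%N && `[< serves q p >].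
  exists p; rewrite leqnn pN; apply/asboolP; apply: le_trans (l_ge p).
  by rewrite ler_wpM2r//; apply/ltW/u_gt0.
have bdq q : (p <= q <= N)%N && `[< serves q p >] -> (q <= N)%N by case/andP => /andP[].
case: (ex_maxnP exq bdq) => q /andP[pqN /asboolP sq] qmax; have /andP[pq qN] := pqN.
have nserve k : (q < k <= N)%N -> ~ serves k p.
  move=> /andP[qk kN] sk; have := qmax k; rewrite kN (leq_trans pq (ltnW qk)) leqNgt qk.
  by move=> /(_ (introT (asboolP _) sk)).
(* At both [T p] and [T q] the line of q is at least eta times that of i; their ratio being
   monotone, this persists at [T i], where l i >= c u. Hence the constant eta * c = c^4 / 2. *)
have cov i : (p <= i <= q)%N -> eta * c * u (T i) <= l q (T i).
  move=> /andP[pi iq]; apply: (@le_trans _ _ (eta * l i (T i))).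
    by rewrite -mulrA ler_wpM2l// ltW.
  apply: (@between _ _ (T p) (T q)) => //; [exact: T_le|exact: T_le| |].
    by apply: le_trans sq; apply: ler_wpM2l; [exact: ltW|exact: l_le].
  apply: le_trans (l_ge q).
  by apply: ler_pM => //; [exact: ltW|exact/ltW/l_gt0|exact: l_le].
have cov2 i : serves q i -> eta * c * u (T i) <= l q (T i).
  by apply: le_trans; rewrite ler_pM2r ?u_gt0// ler_piMr// ltW.
case: (pselect (exists p', (q < p' <= N)%N && `[< ~ serves q p' >])) => [exp'|nex]; last first.
  exists q, [::]; split => // i /andP[pi iN]; exists q; rewrite ?mem_head//.
  case: (leqP i q) => [iq|qi]; first by apply: cov; rewrite pi.
  apply: cov2; apply: contrapT => nsi; apply: nex; exists i; rewrite qi iN.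
  exact/asboolP.
case: (ex_minnP exp') => p' /andP[/andP[qp' p'N] /asboolP np'] p'min.
have [|q' [s [/andP[p'q' q'N] nserve' ch covs]]] := IH p' _ p'N.
  apply: leq_trans hm; apply: ltn_sub2l; last exact: leq_ltn_trans pq qp'.
  exact: leq_ltn_trans pq (leq_trans qp' p'N).
exists q, (q' :: s); split => //=; first by split => //; exact: (linkedP qp').
move=> i /andP[pi iN]; case: (leqP i q) => [iq|qi].
  by exists q; rewrite ?mem_head//; apply: cov; rewrite pi.
case: (leqP p' i) => [p'i|ip'].
  have [|k ks hk] := covs i; first by rewrite p'i.
  by exists k => //; rewrite in_cons ks orbT.
exists q; first exact: mem_head.
apply: cov2; apply: contrapT => nsi; have := p'min i; rewrite qi iN.
by move=> /(_ (introT (asboolP _) nsi)); rewrite leqNgt ip'.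
Qed.

Lemma greedy_selection : exists s : seq nat,
  (forall t, 0 < t -> t < 1 -> \sum_(k <- s) a k * t ^+ d k <= 6 * u t) /\
  (forall i, (i <= N)%N -> exists2 k, k \in s & c ^+ 4 / 2 * u (T i) <= a k * T i ^+ d k).
Proof.
have [q [s [_ _ ch cov]]] := greedy_chain (leq0n N).
exists (q :: s); split=> [t|i iN]; first exact: chain_sum.
have [k ks hk] := cov i iN; exists k => //; apply: le_trans hk.
by rewrite /eta; have -> : c ^+ 4 / 2 = c ^+ 3 / 2 * c by ring.
Qed.

End GreedySelection.

(** * Integration of complex functions *)

Section ComplexIntegral.
Variable R : realType.
Variable mu : {measure set R -> \bar R}.
Implicit Types (g : R[i] -> R[i]) (k : R -> R[i]) (B : R -> R).

Definition cintegrable k := mu.-integrable `[0, 1[ (EFin \o (fun t => complex.Re (k t))) /\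
  mu.-integrable `[0, 1[ (EFin \o (fun t => complex.Im (k t))).

Definition cintegral k : R[i] :=
  Complex (Rintegral mu `[0, 1[ (fun t => complex.Re (k t)))
          (Rintegral mu `[0, 1[ (fun t => complex.Im (k t))).

Lemma measurable_continuous_in (A : set R) (h : R -> R) : measurable A ->
  {within A, continuous h} -> measurable_fun A h.
Proof. by move=> mA ch; exact: subspace_continuous_measurable_fun. Qed.

Lemma measurable_Re_axis g : (forall z, disc z -> cderivable g z) ->
  measurable_fun (`[0, 1[%classic : set R) (fun t => complex.Re (g (t%:C)%C)).
Proof.
move=> dg; apply: measurable_continuous_in => //; apply: continuous_in_subspaceT => t.
rewrite inE /= in_itv /= => /andP[t0 t1].
apply: (@continuous_Re_horizontal _ g t 0); apply/cderivable_continuous/dg.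
by rewrite /disc (cabs_real t) ger0_norm.
Qed.

Lemma measurable_Im_axis g : (forall z, disc z -> cderivable g z) ->
  measurable_fun (`[0, 1[%classic : set R) (fun t => complex.Im (g (t%:C)%C)).
Proof.
move=> dg.
have -> : (fun t => complex.Im (g (t%:C)%C)) =
    (fun t => complex.Re (Complex 0 (-1) * g (t%:C)%C)).
  by apply: funext => t; case: (g _) => x y /=; rewrite mul0r mulN1r opprK add0r.
apply: (@measurable_Re_axis (fun z => Complex 0 (-1) * g z)) => z dz.
by apply: cderivableM; [exact: cderivable_cst|exact: dg].
Qed.

Lemma le_integrable_real (h B : R -> R) : measurable_fun (`[0, 1[%classic : set R) h ->
  (forall t, 0 <= t -> t < 1 -> `|h t| <= B t) ->
  mu.-integrable `[0, 1[ (EFin \o B) -> mu.-integrable `[0, 1[ (EFin \o h).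
Proof.
move=> mh hB; apply: le_integrable => //; first exact/measurable_EFinP.
move=> t /=; rewrite in_itv /= => /andP[t0 t1].
by rewrite lee_fin (le_trans (hB t t0 t1))// ler_norm.
Qed.

Lemma le_Rintegral_norm (h B : R -> R) : measurable_fun (`[0, 1[%classic : set R) h ->
  (forall t, 0 <= t -> t < 1 -> `|h t| <= B t) ->
  mu.-integrable `[0, 1[ (EFin \o B) ->
  `|Rintegral mu `[0, 1[ h| <= Rintegral mu `[0, 1[ B.
Proof.
move=> mh hB iB; have ih := le_integrable_real mh hB iB.
apply: le_trans (le_normr_Rintegral _ ih) _ => //.
apply: le_Rintegral => //; first exact: (integrable_norm ih).
by move=> t /=; rewrite in_itv /= => /andP[t0 t1]; exact: hB.
Qed.

(** Real and imaginary parts are bounded separately, whence the factor 2; only finiteness of the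
    constants matters. *)
Lemma cintegral_bound g B : (forall z, disc z -> cderivable g z) ->
  (forall t, 0 <= t -> t < 1 -> cabs (g (t%:C)%C) <= B t) ->
  mu.-integrable `[0, 1[ (EFin \o B) ->
  cintegrable (fun t => g (t%:C)%C) /\
  cabs (cintegral (fun t => g (t%:C)%C)) <= 2 * Rintegral mu `[0, 1[ B.
Proof.
move=> dg gB iB.
have mRe := measurable_Re_axis dg; have mIm := measurable_Im_axis dg.
have bRe t : 0 <= t -> t < 1 -> `|complex.Re (g (t%:C)%C)| <= B t.
  by move=> t0 t1; apply: le_trans (normr_Re_le _) (gB t t0 t1).
have bIm t : 0 <= t -> t < 1 -> `|complex.Im (g (t%:C)%C)| <= B t.
  by move=> t0 t1; apply: le_trans (normr_Im_le _) (gB t t0 t1).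
split.
  by split; [exact: (le_integrable_real mRe bRe)|exact: (le_integrable_real mIm bIm)].
apply: le_trans (cabs_le_ReIm _) _; rewrite mulr2n mulrDl mul1r.
by apply: lerD; exact: le_Rintegral_norm.
Qed.

Lemma cintegral_lin k1 k2 k3 (h : R[i]) :
  cintegrable k1 -> cintegrable k2 -> cintegrable k3 ->
  cintegral (fun t => k1 t - k2 t - k3 t * h) =
  cintegral k1 - cintegral k2 - cintegral k3 * h.
Proof.
move=> [r1 i1] [r2 i2] [r3 i3]; case: h => x y.
have mD : measurable (`[0, 1[%classic : set R) by [].
have Z (q : R -> R) (s : R) : mu.-integrable `[0, 1[ (EFin \o q) ->
    mu.-integrable `[0, 1[ (EFin \o (fun t => q t * s)).
  move=> iq; rewrite (_ : EFin \o _ = (fun t => (s%:E * (EFin \o q) t)%E)).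
    exact: integrableZl.
  by apply: funext => t /=; rewrite -EFinM mulrC.
have Bi (q q' : R -> R) : mu.-integrable `[0, 1[ (EFin \o q) ->
    mu.-integrable `[0, 1[ (EFin \o q') ->
    mu.-integrable `[0, 1[ (EFin \o (fun t => q t - q' t)).
  by move=> iq iq'; exact: (integrableB mD iq iq').
have Di (q q' : R -> R) : mu.-integrable `[0, 1[ (EFin \o q) ->
    mu.-integrable `[0, 1[ (EFin \o q') ->
    mu.-integrable `[0, 1[ (EFin \o (fun t => q t + q' t)).
  by move=> iq iq'; exact: (integrableD mD iq iq').
pose I h := Rintegral mu `[0, 1[ h.
pose rk k t := complex.Re (k t); pose ik k t := complex.Im (k t).
have -> : cintegral k1 - cintegral k2 - cintegral k3 * Complex x y =
    Complex (I (rk k1) - I (rk k2) - (I (rk k3) * x - I (ik k3) * y))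
            (I (ik k1) - I (ik k2) - (I (rk k3) * y + I (ik k3) * x)).
  by rewrite /cintegral; simpc; congr Complex; rewrite /I /rk /ik; ring.
congr Complex.
- transitivity (I (fun t => rk k1 t - rk k2 t - (rk k3 t * x - ik k3 t * y))).
    by apply: eq_Rintegral => t _; rewrite /rk /ik; case: (k1 t) (k2 t) (k3 t) => [? ?] [? ?] [? ?].
  rewrite /I RintegralB//; [|exact: Bi|by apply: Bi; exact: Z].
  rewrite RintegralB// (@RintegralB _ _ _ _ _ (fun t => rk k3 t * x))//; try exact: Z.
  by rewrite !RintegralZr.
- transitivity (I (fun t => ik k1 t - ik k2 t - (rk k3 t * y + ik k3 t * x))).
    by apply: eq_Rintegral => t _; rewrite /rk /ik; case: (k1 t) (k2 t) (k3 t) => [? ?] [? ?] [? ?].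
  rewrite /I RintegralB//; [|exact: Bi|by apply: Di; exact: Z].
  rewrite RintegralB// RintegralD//; try exact: Z.
  by rewrite !RintegralZr.
Qed.

End ComplexIntegral.

(** * Sufficiency *)

Section Sufficiency.
Variable R : realType.
Variable mu : {measure set R -> \bar R}.
Variables v w : R -> R.
Hypothesis wv : is_weight v.
Hypothesis ww : is_weight w.
Implicit Types (f : R[i] -> R[i]).

Definition cauchy_weight (r t : R) : R := (v t * (1 - t * r))^-1.

Let vpos r : 0 <= r -> r < 1 -> 0 < v r. Proof. by case: wv => + _ _ _; apply. Qed.

Lemma cauchy_weight_gt0 r t : 0 <= r -> r < 1 -> 0 <= t -> t < 1 -> 0 < cauchy_weight r t.
Proof. by move=> r0 r1 t0 t1; rewrite invr_gt0 mulr_gt0 ?vpos//; nra. Qed.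

Lemma measurable_cauchy_weight r : 0 <= r -> r < 1 ->
  measurable_fun (`[0, 1[%classic : set R) (cauchy_weight r).
Proof.
move=> r0 r1; apply: measurable_continuous_in => //.
case: wv => _ /subspace_continuousP cv _ _; apply/subspace_continuousP => t It.
have /andP[t0 t1] : 0 <= t < 1 by move: It; rewrite /= in_itv.
apply: cvgV.
  by rewrite mulf_neq0// gt_eqF ?vpos//; nra.
apply: cvgM; first exact: cv.
apply: cvg_within_filter; apply: cvgB; first exact: cvg_cst.
by apply: cvgM; [exact: cvg_id|exact: cvg_cst].
Qed.

Lemma kernel_den_ge (z : R[i]) (t : R) : disc z -> 0 <= t -> t < 1 ->
  1 - t * cabs z <= cabs (1 - (t%:C)%C * z).
Proof.
move=> dz t0 t1; have := lerB_cabs 1 (- ((t%:C)%C * z)).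
by rewrite cabsN cabsM cabs_real ger0_norm// cabs1.
Qed.

Lemma disc_mul_neq1 (y z : R[i]) : disc y -> disc z -> 1 - y * z != 0.
Proof.
move=> dy dz; rewrite -cabs_gt0; have := lerB_cabs 1 (- (y * z)).
rewrite cabsN cabsM cabs1; apply: lt_le_trans.
by move: dy dz; rewrite /disc; have := cabs_ge0 y; have := cabs_ge0 z; nra.
Qed.

Lemma cderivable_kernel (z y : R[i]) : disc z -> disc y ->
  cderivable (fun y => (1 - y * z)^-1) y.
Proof.
move=> dz dy; apply: (@cderivableV _ (fun y => 1 - y * z)); first exact: disc_mul_neq1.
have -> : (fun y => 1 - y * z) = (fun y => 1 + y * - z) by apply: funext => x; rewrite mulrN.
apply: cderivableD; first exact: cderivable_cst.
by apply: cderivableM; [exact: cderivable_id|exact: cderivable_cst].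
Qed.

Lemma Imu_cintegral f z : Imu mu f z = cintegral mu (Ikernel f z).
Proof. by []. Qed.

Hypothesis Cfin : Cvw_finite mu v w.

Let K r := Rintegral mu `[0, 1[ (cauchy_weight r).

Lemma cauchy_weight_integrable r : 0 <= r -> r < 1 ->
  mu.-integrable `[0, 1[ (EFin \o cauchy_weight r).
Proof.
move=> r0 r1; have [C HC] := Cfin; have wr : 0 < w r by case: ww => + _ _ _; apply.
apply/integrableP; split; first by apply/measurable_EFinP; exact: measurable_cauchy_weight.
have -> : (\int[mu]_(t in `[0%R, 1%R[) `|(EFin \o cauchy_weight r) t| =
    \int[mu]_(t in `[0%R, 1%R[) ((v t * (1 - t * r))^-1)%:E)%E.
  apply: eq_integral => t; rewrite inE /= in_itv /= => /andP[t0 t1].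
  by rewrite gtr0_norm// cauchy_weight_gt0.
(* As w r > 0, an infinite integral would make the product infinite, contradicting the real
   bound. *)
rewrite ltey; apply/eqP => E; have := HC r r0 r1.
by rewrite E gt0_muley// leye_eq.
Qed.

Let K_le : exists C, forall r, 0 <= r -> r < 1 -> w r * K r <= C.
Proof.
have [C HC] := Cfin; exists C => r r0 r1; rewrite -lee_fin EFinM.
apply: le_trans (HC r r0 r1); rewrite /K /Rintegral fineK//.
exact: (integrable_fin_num _ (cauchy_weight_integrable r0 r1)).
Qed.

Lemma kernel_bound f (M : R) z (t : R) : vbounded v f M -> disc z -> 0 <= t -> t < 1 ->
  cabs (Ikernel f z t) <= M * cauchy_weight (cabs z) t.
Proof.
move=> fM dz t0 t1; rewrite /Ikernel cabs_div /cauchy_weight invfM mulrA.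
have dt : disc (t%:C)%C by rewrite /disc cabs_real ger0_norm.
have := fM _ dt; rewrite cabs_real ger0_norm// => ft.
have vt := vpos t0 t1; have := kernel_den_ge dz t0 t1; have z0 := cabs_ge0 z.
have den : 0 < 1 - t * cabs z by move: dz; rewrite /disc; nra.
move=> h; apply: ler_pM; rewrite ?invr_ge0 ?cabs_ge0//.
  by rewrite ler_pdivlMr// mulrC.
by rewrite lef_pV2 ?posrE//; lra.
Qed.

Let scaled_integrable (M r : R) : 0 <= r -> r < 1 ->
  mu.-integrable `[0, 1[ (EFin \o (fun t => M * cauchy_weight r t)).
Proof. by move=> r0 r1; exact: (integrableZl _ _ (cauchy_weight_integrable r0 r1)). Qed.

Let scaled_Rintegral (M r : R) : 0 <= r -> r < 1 ->
  Rintegral mu `[0, 1[ (fun t => M * cauchy_weight r t) = M * K r.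
Proof. by move=> r0 r1; rewrite RintegralZl//; exact: cauchy_weight_integrable. Qed.

Lemma Ikernel_cintegral f M z : holo_disc f -> vbounded v f M -> disc z ->
  cintegrable mu (Ikernel f z) /\ cabs (Imu mu f z) <= 2 * (M * K (cabs z)).
Proof.
move=> /holo_discP hf fM dz; rewrite -scaled_Rintegral ?cabs_ge0//.
apply: (@cintegral_bound _ _ (fun y => f y / (1 - y * z))).
- move=> y dy; apply: cderivableM; first exact: hf.
  exact: cderivable_kernel.
- by move=> t t0 t1; exact: (kernel_bound fM dz).
- by apply: scaled_integrable => //; exact: cabs_ge0.
Qed.

(* 1/(1-t(z+h)) - 1/(1-tz) - th/(1-tz)^2 = t^2 h^2 / ((1-t(z+h)) (1-tz)^2) *)
Lemma Imu_holo f M : holo_disc f -> vbounded v f M -> holo_disc (Imu mu f).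
Proof.
move=> hf fM; have /holo_discP df := hf; apply/holo_discP => z dz.
have M0 : 0 <= M.
  have d0 : disc (0 : R[i]) by rewrite /disc cabs0.
  apply: le_trans (fM _ d0); rewrite mulr_ge0 ?cabs_ge0// ltW//.
  by apply: vpos; rewrite cabs0.
pose s := 1 - cabs z; have s0 : 0 < s by rewrite subr_gt0.
have z0 := cabs_ge0 z.
have df2 y : disc y -> cderivable (fun y => f y * (y * (1 - y * z)^-1 * (1 - y * z)^-1)) y.
  move=> dy; apply: cderivableM; first exact: df.
  apply: cderivableM; last exact: cderivable_kernel.
  by apply: cderivableM; [exact: cderivable_id|exact: cderivable_kernel].
have den (t : R) : 0 <= t -> t < 1 -> s <= cabs (1 - (t%:C)%C * z).
  by move=> t0 t1; apply: le_trans (kernel_den_ge dz t0 t1); rewrite /s; nra.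
have i2 : mu.-integrable `[0, 1[ (EFin \o (fun t => M * s^-2 * cauchy_weight 0 t)).
  exact: scaled_integrable.
have bound2 (t : R) : 0 <= t -> t < 1 ->
    cabs (f (t%:C)%C * ((t%:C)%C * (1 - (t%:C)%C * z)^-1 * (1 - (t%:C)%C * z)^-1)) <=
    M * s^-2 * cauchy_weight 0 t.
  move=> t0 t1.
  have d0 : disc (0 : R[i]) by rewrite /disc cabs0.
  have := kernel_bound fM d0 t0 t1; rewrite /Ikernel mulr0 subr0 divr1 cabs0 => ft.
  have ct := cauchy_weight_gt0 (lexx 0) ltr01 t0 t1.
  rewrite (mulrAC M) cabsM; apply: ler_pM; rewrite ?cabs_ge0//.
  rewrite !cabsM !cabsV cabs_real ger0_norm// -mulrA -invfM -expr2.
  apply: (@le_trans _ _ (cabs (1 - (t%:C)%C * z) ^+ 2)^-1).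
    by rewrite ler_piMl ?invr_ge0 ?sqr_ge0// ltW.
  have dt := den t t0 t1.
  rewrite lef_pV2 ?posrE ?exprn_gt0//; last by lra.
  by rewrite ler_pXn2r ?nnegrE ?cabs_ge0// ltW.
have [ci2 _] := cintegral_bound df2 bound2 i2.
pose d := cintegral mu (fun t => f (t%:C)%C * ((t%:C)%C * (1 - (t%:C)%C * z)^-1 * (1 - (t%:C)%C * z)^-1)).
apply/derivable_cabsP; exists d => e e0.
(* The outer 2 is that of [cintegral_bound]; 2 s^-3 bounds the denominators as (s/2)^-1 * s^-2; the
   summand 1 makes L positive. *)
pose L := 2 * (M * (2 * s^-3) * K 0) + 1.
have K0 : 0 <= K 0.
  apply: Rintegral_ge0 => t; rewrite /= in_itv /= => /andP[t0 t1].
  exact/ltW/cauchy_weight_gt0.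
have L0 : 0 < L.
  by rewrite ltr_wpDl// !mulr_ge0// invr_ge0 exprn_ge0// ltW.
(* s / 2 keeps z + h in the disc and 1 - t (z + h) at distance at least s / 2 from 0; e / L turns
   the quadratic remainder into e |h|. *)
exists (Num.min (s / 2) (e / L)); first by rewrite lt_min !divr_gt0.
move=> h; rewrite lt_min => /andP[hs he].
have dzh : disc (z + h).
  by rewrite /disc; apply: le_lt_trans (ler_cabsD _ _) _; move: hs s0; rewrite /s; lra.
have [ci1 _] := Ikernel_cintegral hf fM dzh.
have [ci0 _] := Ikernel_cintegral hf fM dz.
rewrite !Imu_cintegral -cintegral_lin//.
pose g y := f y * ((1 - y * (z + h))^-1 - (1 - y * z)^-1 - y * (1 - y * z)^-1 * (1 - y * z)^-1 * h).
rewrite (_ : (fun t => _) = (fun t : R => g (t%:C)%C)); last first.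
  by apply: funext => t; rewrite /g /Ikernel; ring.
have h0 := cabs_ge0 h.
have Bint : mu.-integrable `[0, 1[ (EFin \o (fun t => M * (2 * s^-3) * cabs h ^+ 2 * cauchy_weight 0 t)).
  exact: scaled_integrable.
have [||_ ] := cintegral_bound _ _ Bint (g := g).
- move=> y dy; apply: cderivableM; first exact: df.
  have -> : (fun y => (1 - y * (z + h))^-1 - (1 - y * z)^-1 - y * (1 - y * z)^-1 * (1 - y * z)^-1 * h) =
    (fun y => (1 - y * (z + h))^-1 + (-1) * (1 - y * z)^-1 + y * (1 - y * z)^-1 * (1 - y * z)^-1 * (- h)).
    by apply: funext => x; ring.
  apply: cderivableD.
    apply: cderivableD; first exact: cderivable_kernel.
    by apply: cderivableM; [exact: cderivable_cst|exact: cderivable_kernel].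
  apply: cderivableM; last exact: cderivable_cst.
  apply: cderivableM; last exact: cderivable_kernel.
  by apply: cderivableM; [exact: cderivable_id|exact: cderivable_kernel].
- move=> t t0 t1.
  have d0 : disc (0 : R[i]) by rewrite /disc cabs0.
  have dt : disc (t%:C)%C by rewrite /disc cabs_real ger0_norm.
  have := kernel_bound fM d0 t0 t1; rewrite /Ikernel mulr0 subr0 divr1 cabs0 => ft.
  have ct := cauchy_weight_gt0 (lexx 0) ltr01 t0 t1.
  have n1 := disc_mul_neq1 dt dz; have n2 := disc_mul_neq1 dt dzh.
  have -> : g (t%:C)%C = f (t%:C)%C * (((t%:C)%C * h) ^+ 2 *
      ((1 - (t%:C)%C * (z + h))^-1 * ((1 - (t%:C)%C * z) ^+ 2)^-1)).
    by rewrite /g; congr (_ * _); field; rewrite n1 n2.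
  have -> : M * (2 * s^-3) * cabs h ^+ 2 * cauchy_weight 0 t =
    M * cauchy_weight 0 t * (cabs h ^+ 2 * (2 * s^-3)) by ring.
  rewrite cabsM.
  have dent := den t t0 t1.
  have den2 : s / 2 <= cabs (1 - (t%:C)%C * (z + h)).
    by apply: le_trans (kernel_den_ge dzh t0 t1); have := ler_cabsD z h; have := cabs_ge0 (z + h); move: hs s0; rewrite /s; nra.
  apply: ler_pM; rewrite ?cabs_ge0//.
  rewrite cabsM; apply: ler_pM; rewrite ?cabs_ge0//.
    rewrite cabsX ler_pXn2r ?nnegrE ?cabs_ge0// cabsM cabs_real ger0_norm//.
    by rewrite ler_piMl// ltW.
  rewrite cabsM !cabsV cabsX.
  have -> : 2 * s^-3 = (s / 2)^-1 * (s ^+ 2)^-1 by field; rewrite gt_eqF.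
  apply: ler_pM; rewrite ?invr_ge0 ?exprn_ge0 ?cabs_ge0//.
    by rewrite lef_pV2 ?posrE; lra.
  by rewrite lef_pV2 ?posrE ?exprn_gt0 ?ler_pXn2r ?nnegrE ?cabs_ge0//; lra.
move=> /le_trans; apply; rewrite scaled_Rintegral//.
have -> : 2 * (M * (2 * s^-3) * cabs h ^+ 2 * K 0) = (L - 1) * cabs h * cabs h by rewrite /L; ring.
rewrite ler_wpM2r//; move: he; rewrite ltr_pdivlMr//; nra.
Qed.

Lemma Cvw_finite_Imu_bounded : Imu_bounded mu v w.
Proof.
have [C KC] := K_le.
have wpos r : 0 <= r -> r < 1 -> 0 < w r by case: ww => + _ _ _; apply.
have bd f M : holo_disc f -> vbounded v f M -> vbounded w (Imu mu f) (2 * C * M).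
  move=> hf fM z dz; have [_ h] := Ikernel_cintegral hf fM dz.
  have d0 : disc (0 : R[i]) by rewrite /disc cabs0.
  have M0 : 0 <= M.
    apply: le_trans (fM _ d0); rewrite mulr_ge0 ?cabs_ge0// ltW//.
    by apply: vpos; rewrite cabs0.
  have wz := wpos _ (cabs_ge0 z) dz; have KCz := KC _ (cabs_ge0 z) dz.
  apply: (@le_trans _ _ (w (cabs z) * (2 * (M * K (cabs z))))).
    by rewrite ler_wpM2l// ltW.
  have -> : w (cabs z) * (2 * (M * K (cabs z))) = 2 * M * (w (cabs z) * K (cabs z)) by ring.
  have -> : 2 * C * M = 2 * M * C by ring.
  by apply: ler_wpM2l => //; lra.
split; last by exists (2 * C) => f M; exact: bd.
move=> f [hf [M fM]]; split; first by move=> z dz; exact: (Ikernel_cintegral hf fM dz).1.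
by split; [exact: (Imu_holo hf fM)|exists (2 * C * M); exact: bd].
Qed.

End Sufficiency.

(** * Necessity *)

Section Necessity.
Variable R : realType.
Variables v w : R -> R.
Hypothesis wv : is_weight v.
Hypothesis ww : is_weight w.

Let vpos r : 0 <= r -> r < 1 -> 0 < v r. Proof. by case: wv => + _ _ _; apply. Qed.

Let vmono r s : 0 <= r -> r <= s -> s < 1 -> v s <= v r.
Proof. by case: wv => _ _ + _; apply. Qed.

(** Of the final c / 4, one factor 1/2 pays for a function that only nearly attains the supremum at
    t, the other for the factor t >= 1/2 lost in [monomial_minorant]. *)
Lemma essential_minorant : essential v -> exists2 c : R, 0 < c <= 1 &
  forall t, 1 / 2 <= t -> t < 1 -> exists a n, [/\ 0 < a,
    (forall r, 0 <= r -> r < 1 -> a * r ^+ n.+1 <= (v r)^-1) &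
    c * (v t)^-1 <= a * t ^+ n.+1].
Proof.
move=> [c c0 ev].
have c1 : c <= 1.
  have d0 : disc (0 : R[i]) by rewrite /disc cabs0.
  have [h1 h2] := ev 0 d0.
  by move: (le_trans h1 h2); rewrite ler_pM2r// invr_gt0 vpos// cabs0.
exists (c / 4) => [|t t2 t1]; first by apply/andP; split; lra.
have dt : disc (t%:C)%C by rewrite /disc cabs_real ger0_norm; lra.
have vt : 0 < v t by apply: vpos; lra.
have [h1 _] := ev _ dt; rewrite (cabs_real t) ger0_norm in h1; last by lra.
set S := [set _ | _ in _] in h1.
(* Without this, [sup] could be a mere default value and no near-extremal function would exist. *)
have hS : has_sup S.
  split.
    exists 0; exists (fun=> 0); last exact: cabs0.
    split; first by apply/holo_discP => z _; exact: cderivable_cst.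
    by move=> z _; rewrite cabs0 mulr0.
  exists (v t)^-1 => _ [f [_ fb] <-].
  rewrite -[leRHS]mul1r ler_pdivlMr// mulrC.
  by have := fb _ dt; rewrite (cabs_real t) ger0_norm//; lra.
have [|_ [f [hf fb] <-] hft] := @sup_adherent _ S (c / v t / 2) _ hS.
  by rewrite !divr_gt0.
have ft : c / v t / 2 < cabs (f (t%:C)%C) by lra.
have cvt : 0 < c / v t by rewrite divr_gt0.
have t0 : 0 < t by lra.
have [a [n [a0 al ae]]] := monomial_minorant vpos vmono hf fb t0 t1 ltac:(lra).
exists a, n; split => //.
  move=> r r0 r1; rewrite -[leRHS]mul1r ler_pdivlMr ?vpos// mulrC.
  exact: al.
have -> : c / 4 * (v t)^-1 = 1 / 2 * (c / v t / 2) by field; rewrite gt_eqF.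
by rewrite ae; nra.
Qed.

(** Levels at which 1/v doubles: between neighbours 1/v varies by a factor at most 2, so it suffices
    to control F at the levels. They start at 1/2 because the minorants are available only from
    there. *)
Lemma weight_levels : exists T : nat -> R,
  forall k, [/\ 1 / 2 <= T k, T k < 1 & v (T k) = v (1 / 2) / 2 ^+ k].
Proof.
suff /choice[T TP] : forall k, exists t, [/\ 1 / 2 <= t, t < 1 & v t = v (1 / 2) / 2 ^+ k].
  by exists T.
move=> k; have v2 : 0 < v (1 / 2) by apply: vpos; lra.
have e0 : 0 < v (1 / 2) / 2 ^+ k by rewrite divr_gt0// exprn_gt0.
have [b [vb b2 b1]] : exists b, [/\ v b <= v (1 / 2) / 2 ^+ k, 1 / 2 <= b & b < 1].
  case: wv => _ _ _ /cvgrPdist_le/(_ _ e0) vl.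
  have : \forall x \near (1 : R)^'-, [/\ v x <= v (1 / 2) / 2 ^+ k, 1 / 2 <= x & x < 1].
    near=> x.
    have x2 : 1 / 2 <= x by near: x; apply: nbhs_left_ge; lra.
    have x1 : x < 1 by near: x; exact: nbhs_left_lt.
    split => //; have : `|0 - v x| <= v (1 / 2) / 2 ^+ k by near: x.
    by rewrite sub0r normrN; apply: le_trans; exact: ler_norm.
  exact: (@filter_ex _ _ (at_left_proper_filter (1 : R))).

have cv : {within `[1 / 2, b], continuous v}.
  case: wv => _ + _ _; apply: continuous_subspaceW => x /=.
  by rewrite !in_itv /= => /andP[h1 h2]; apply/andP; split; lra.
have kle : v (1 / 2) / 2 ^+ k <= v (1 / 2).
  rewrite ler_pdivrMr ?exprn_gt0// ler_peMr ?(ltW v2)//.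
  by rewrite exprn_ege1//; lra.
have [|t] := IVT b2 cv (v := v (1 / 2) / 2 ^+ k).
  by rewrite ge_min le_max vb kle orbT.
by rewrite in_itv /= => /andP[t2 tb] vt; exists t; split => //; lra.
Unshelve. all: by end_near.
Qed.

Variable mu : {measure set R -> \bar R}.

Lemma Imu_bounded_Cvw_finite : essential v -> Imu_bounded mu v w -> Cvw_finite mu v w.
Proof.
move=> /essential_minorant[c /andP[c0 c1] minor] [welldef [C bdd]].
have [T TP] := weight_levels.
have T2 k : 1 / 2 <= T k by have [] := TP k.
have T1 k : T k < 1 by have [] := TP k.
have Tv k : v (T k) = v (1 / 2) / 2 ^+ k by have [] := TP k.
have T0 k : 0 < T k by have := T2 k; lra.
have v2 : 0 < v (1 / 2) by apply: vpos; lra.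
have Tincr i j : (i < j)%N -> T i < T j.
  move=> ij; rewrite ltNge; apply/negP => Tji.
  have := vmono (ltW (T0 j)) Tji (T1 i); rewrite !Tv ler_pM2l// lef_pV2 ?posrE ?exprn_gt0//.
  by rewrite ler_eXn2l ?ltr1n// leqNgt ij.
have /choice[a /choice[d lP]] : forall k, exists a n, [/\ 0 < a,
    (forall r, 0 <= r -> r < 1 -> a * r ^+ n.+1 <= (v r)^-1) &
    c * (v (T k))^-1 <= a * T k ^+ n.+1].
  by move=> k; exact: minor.
have a0 k : 0 < a k by have [] := lP k.
(* In M, v 0 bounds the term 1 and 6 the selected monomials. In c2, v (1/2) serves the points up to
   [T 0], where the term 1 suffices, and c^4 / 4 is the greedy constant halved by the gap between
   two levels. *)
pose M := v 0 + 6; pose c2 := Num.min (v (1 / 2)) (c ^+ 4 / 4).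
have c20 : 0 < c2 by rewrite lt_min v2 divr_gt0// exprn_gt0.
pose P s t : R := 1 + \sum_(k <- s) a k * t ^+ (d k).+1.
pose F s (z : R[i]) : R[i] := 1 + \sum_(k <- s) (a k)%:C%C * z ^+ (d k).+1.
have FP s (t : R) : F s (t%:C)%C = (P s t)%:C%C.
  rewrite /F /P rmorphD rmorph1 rmorph_sum; congr (_ + _).
  by apply: eq_bigr => k _; rewrite rmorphM rmorphXn.
have P1 s t : 0 <= t -> 1 <= P s t.
  move=> t0; rewrite lerDl sumr_ge0// => k _.
  by rewrite mulr_ge0 ?exprn_ge0// ltW.
have FleP s z : cabs (F s z) <= P s (cabs z).
  apply: le_trans (ler_cabsD _ _) _; rewrite cabs1 lerD2l.
  elim: s => [|k s IH]; first by rewrite !big_nil cabs0.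
  rewrite !big_cons; apply: le_trans (ler_cabsD _ _) _; apply: lerD => //.
  by rewrite cabsM cabsX cabs_real gtr0_norm.
have Fholo s : holo_disc (F s).
  apply/holo_discP => z _; apply: cderivableD; first exact: cderivable_cst.
  elim: s => [|k s IH].
    have -> : (fun z : R[i] => \sum_(k <- [::]) (a k)%:C%C * z ^+ (d k).+1) = (fun=> 0).
      by apply: funext => y; rewrite big_nil.
    exact: cderivable_cst.
  have -> : (fun z : R[i] => \sum_(k <- k :: s) (a k)%:C%C * z ^+ (d k).+1) =
    (fun z => (a k)%:C%C * z ^+ (d k).+1 + \sum_(k <- s) (a k)%:C%C * z ^+ (d k).+1).
    by apply: funext => y; rewrite big_cons.
  apply: cderivableD; last exact: IH.
  apply: cderivableM; first exact: cderivable_cst.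
  by apply: (@cderivableX _ (fun z => z)); exact: cderivable_id.
have sel N : exists s, vbounded v (F s) M /\
    forall t, 0 <= t -> t <= T N -> c2 * (v t)^-1 <= P s t.
  have [|||||||||s [sle sge]] := @greedy_selection R (fun r => (v r)^-1) a (fun k => (d k).+1) T c N.
  - by move=> r r0 r1; rewrite invr_gt0 vpos// ltW.
  - exact: a0.
  - exact: T0.
  - exact: T1.
  - exact: Tincr.
  - exact: c0.
  - exact: c1.
  - by move=> k r r0 r1; have [_ + _] := lP k; apply => //; exact: ltW.
  - by move=> k; have [_ _] := lP k.
  exists s; split.
    move=> z dz; apply: le_trans (ler_wpM2l (ltW (vpos (cabs_ge0 z) dz)) (FleP s z)) _.
    have [->|z0] := eqVneq (cabs z) 0.
      rewrite /P big1 ?addr0 ?mulr1 /M; first by lra.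
      by move=> k _; rewrite expr0n mulr0.
    have zp : 0 < cabs z by rewrite lt0r z0 cabs_ge0.
    have vz := vpos (ltW zp) dz; have := sle _ zp dz.
    rewrite -ler_pdivrMl ?invr_gt0// => h.
    have := vmono (lexx 0) (ltW zp) dz.
    have : v (cabs z) * \sum_(k <- s) a k * cabs z ^+ (d k).+1 <= 6.
      apply: le_trans (ler_wpM2l (ltW vz) (sle _ zp dz)) _.
      by rewrite mulrCA divff ?mulr1// gt_eqF.
    by rewrite /P mulrDr mulr1 /M; lra.
  move=> t t0 tN; have t1 : t < 1 by exact: le_lt_trans (T1 N).
  have vt := vpos t0 t1.
  have exk : exists k, t <= T k by exists N.
  (* [T k] is the first level at or beyond t. For k > 0 the previous level lies below t: F increases
     from there, and v at that level is at most 2 v t. *)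
  case: (ex_minnP exk) => k tk kmin; have kN := kmin N tN.
  have Pt := P1 s t t0.
  rewrite ler_pdivrMr//; case: k tk kmin kN => [|k] tk kmin kN.
    have : v (1 / 2) <= v t.
      by have := vmono t0 tk (T1 0%N); rewrite Tv expr0 divr1.
    have : c2 <= v (1 / 2) by rewrite ge_min lexx.
    by nra.
  have Tkt : T k < t by rewrite ltNge; apply/negP => /kmin; rewrite ltnn.
  have [j js hj] := sge k (ltnW kN).
  have Pj : c ^+ 4 / 2 * (v (T k))^-1 <= P s t.
    apply: le_trans hj _; apply: (@le_trans _ _ (a j * t ^+ (d j).+1)).
      by rewrite ler_pM2l// ler_pXn2r ?nnegrE//; exact: ltW.
    rewrite /P (big_rem j js) /= addrCA lerDl addr_ge0// sumr_ge0// => i _.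
    by rewrite mulr_ge0 ?exprn_ge0// ltW.
  have vk : v (T k) <= 2 * v t.
    have := vmono t0 tk (T1 k.+1); rewrite !Tv exprS invfM mulrCA mulrA.
    by rewrite -mulrA; lra.
  have vTk : 0 < v (T k) by apply: vpos => //; exact: ltW.
  move: Pj; rewrite ler_pdivrMr// => Pj.
  have : c2 <= c ^+ 4 / 4 by rewrite ge_min lexx orbT.
  by nra.
have C0 : 0 <= C * M.
  have [s [sb _]] := sel 0%N.
  have d0 : disc (0 : R[i]) by rewrite /disc cabs0.
  apply: le_trans (bdd _ _ (Fholo s) sb _ d0); rewrite cabs0 mulr_ge0 ?cabs_ge0// ltW//.
  by case: ww => + _ _ _; apply.
exists (C * M / c2) => r r0 r1.
have wr : 0 < w r by case: ww => + _ _ _; apply.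
have dr : disc (r%:C)%C by rewrite /disc cabs_real ger0_norm.
have mG := measurable_cauchy_weight wv r0 r1.
have step N : (\int[mu]_(t in `[0%R, T N[) (cauchy_weight v r t)%:E <=
    (C * M / c2 / w r)%:E)%E.
  have [s [sb sP]] := sel N.
  have Fin : in_Hinf v (F s) by split; [exact: Fholo|exists M].
  (* Well-definedness in (ii) supplies the integrability that lets the bound on the real-valued
     integral pass to the extended one. *)
  have [iRe _] := (welldef _ Fin).1 _ dr.
  (* At a real point r the kernel of F is real and nonnegative, so the modulus of [I_mu] F dominates
     the full integral. *)
  have kE t : complex.Re (Ikernel (F s) (r%:C)%C t) = P s t / (1 - t * r).
    rewrite /Ikernel FP -rmorphM -(rmorph1 (real_complex R)) -rmorphB -fmorphV -rmorphM.
    by [].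
  have den t : 0 <= t -> t < 1 -> 0 < 1 - t * r by move=> t0 t1; nra.
  have ker_ge0 t : 0 <= t -> t < 1 -> 0 <= P s t / (1 - t * r).
    by move=> t0 t1; rewrite divr_ge0//; [have := P1 s t t0; lra|exact/ltW/den].
  have := bdd _ _ (Fholo s) sb _ dr; rewrite cabs_real ger0_norm// => hw.
  have hI : w r * Rintegral mu `[0, 1[ (fun t => P s t / (1 - t * r)) <= C * M.
    apply: le_trans hw; apply: ler_wpM2l; first exact: ltW.
    have <- : complex.Re (Imu mu (F s) (r%:C)%C) =
        Rintegral mu `[0, 1[ (fun t => P s t / (1 - t * r)).
      by apply: eq_Rintegral => t _; exact: kE.
    by apply: le_trans (normr_Re_le _); exact: ler_norm.
  have iP : mu.-integrable `[0, 1[ (EFin \o (fun t => P s t / (1 - t * r))).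
    by move: iRe; congr (mu.-integrable _ _ = true); apply: funext => t /=; rewrite kE.
  have i2 : mu.-integrable `[0, 1[ (EFin \o (fun t => c2^-1 * (P s t / (1 - t * r)))).
    exact: (integrableZl _ _ iP).
  apply: (@le_trans _ _ (\int[mu]_(t in `[0%R, 1%R[) (c2^-1 * (P s t / (1 - t * r)))%:E)%E).
    apply: (@le_trans _ _ (\int[mu]_(t in `[0%R, T N[) (c2^-1 * (P s t / (1 - t * r)))%:E)%E).
      apply: ge0_le_integral => //.
      - move=> t; rewrite /= in_itv /= => /andP[t0 tN].
        by rewrite lee_fin ltW// cauchy_weight_gt0//; exact: lt_trans (T1 N).
      - apply/measurable_EFinP; apply: measurable_funS mG => //.
        by move=> t; rewrite /= !in_itv /= => /andP[-> /lt_trans]; apply.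
      - apply: measurable_funS (measurable_int _ i2) => //.
        by move=> t; rewrite /= !in_itv /= => /andP[-> /lt_trans]; apply.
      - move=> t; rewrite /= in_itv /= => /andP[t0 tN]; rewrite lee_fin.
        have t1 := lt_trans tN (T1 N); have := sP t t0 (ltW tN) => h.
        rewrite /cauchy_weight invfM mulrA ler_pM2r ?invr_gt0 ?den//.
        by rewrite ler_pdivlMl.
    apply: ge0_subset_integral => //.
    - exact: (measurable_int _ i2).
    - move=> t; rewrite /= in_itv /= => /andP[t0 t1].
      by rewrite lee_fin; apply: mulr_ge0; [rewrite invr_ge0; exact: ltW|exact: ker_ge0].
    - by move=> t; rewrite /= !in_itv /= => /andP[-> /lt_trans]; apply.
  rewrite -(fineK (integrable_fin_num _ i2))// lee_fin.
  rewrite -[leLHS]/(Rintegral mu `[0, 1[ (fun t => c2^-1 * (P s t / (1 - t * r)))).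
  rewrite RintegralZl// ler_pdivlMr//; move: hI; set I := Rintegral _ _ _ => hI.
  have -> : c2^-1 * I * w r = w r * I / c2 by ring.
  by rewrite ler_pM2r ?invr_gt0.
(* v is positive at t and v ([T N]) tends to 0, so monotonicity of v forces [T N] beyond t. Monotone
   convergence then uses that the bound in [step] is the same for every N. *)
have cover : \bigcup_N `[0, T N[%classic = `[0, 1[%classic :> set R.
  apply/seteqP; split=> t /=.
    by move=> [N _]; rewrite /= !in_itv /= => /andP[-> /lt_trans]; apply.
  rewrite in_itv /= => /andP[t0 t1].
  have [N hN] := exp2_archi (v (1 / 2)) (vpos t0 t1).
  exists N => //; rewrite /= in_itv /= t0 /= ltNge; apply/negP => Tt.
  by have := vmono (ltW (T0 N)) Tt t1; rewrite Tv; lra.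
have lim : (\int[mu]_(t in `[0%R, T N[) (cauchy_weight v r t)%:E @[N --> \oo] -->
    \int[mu]_(t in `[0%R, 1%R[) (cauchy_weight v r t)%:E)%E.
  rewrite -cover; apply: ge0_nondecreasing_set_cvg_integral => //.
  - move=> i j ij; apply/subsetPset => t; rewrite /= !in_itv /= => /andP[-> ti].
    move: ij; rewrite leq_eqVlt => /orP[/eqP <-//|/Tincr]; exact: lt_trans.
  - move=> N; apply/measurable_EFinP; apply: measurable_funS mG => //.
    by move=> t; rewrite /= !in_itv /= => /andP[-> /lt_trans]; apply.
  - move=> N t; rewrite /= in_itv /= => /andP[t0 tN].
    by rewrite lee_fin ltW// cauchy_weight_gt0//; exact: lt_trans (T1 N).
have : (\int[mu]_(t in `[0%R, 1%R[) (cauchy_weight v r t)%:E <= (C * M / c2 / w r)%:E)%E.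
  rewrite -(cvg_lim _ lim)//; apply: lime_le; first by apply/cvg_ex; eexists; exact: lim.
  by apply: nearW => N; exact: step.
rewrite -(@lee_pmul2l _ (w r)%:E)// => /le_trans; apply.
by rewrite -EFinM lee_fin mulrC divfK// gt_eqF.
Qed.

End Necessity.

Theorem theorem8 (R : realType) (mu : {finite_measure set R -> \bar R})
    (v w : R -> R) :
  mu (~` `[0, 1[) = 0%E ->
  is_weight v -> is_weight w ->
  (Cvw_finite mu v w -> Imu_bounded mu v w) /\
  (essential v -> (Imu_bounded mu v w <-> Cvw_finite mu v w)).
Proof.
move=> _ wv ww; split=> [|ev]; first exact: Cvw_finite_Imu_bounded.
by split; [exact: Imu_bounded_Cvw_finite|exact: Cvw_finite_Imu_bounded].
Qed.
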